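(* Let $p \in \mathbb{N}$, let $\mathbf{X} = (X_1,\dots,X_p)$ be an $\mathbb{R}^p$-valued random vector and let $Y$ be a real-valued random variable on a common probability space, such that $Y$ and at least one coordinate of $\mathbf{X}$ are non-degenerate. Let $F_Y$ denote the distribution function of $Y$, let $Y'$ be a conditionally independent copy of $Y$ given $\mathbf{X}$, and consider the Markov product $(F_Y(Y),F_Y(Y'))$ of $(\mathbf{X},F_Y(Y))$. Define $M := \{\mathbf{z} \in \mathbb{R}^p : \mathbb{P}(\mathbf{X}=\mathbf{z}) > 0\}$. Then the following statements are equivalent: (a) $\Lambda(Y|\mathbf{X}) = 1$. (b) $Y$ is completely separated relative to $\mathbf{X}$. (c) $(F_Y(Y),F_Y(Y'))$ admits an ordinal sum structure $(\langle (a_{\mathbf{z}},b_{\mathbf{z}}], F_{\mathbf{z}} \rangle)_{\mathbf{z} \in M}$ of size $|M|$ such that, for every $\mathbf{z} \in M$, $b_{\mathbf{z}} - a_{\mathbf{z}} = \mathbb{P}(\mathbf{X}=\mathbf{z})$ and $F_{\mathbf{z}}(u,v) = F_{\mathbf{z}}(u,b_{\mathbf{z}}) \cdot F_{\mathbf{z}}(b_{\mathbf{z}},v)$ for all $(u,v) \in (a_{\mathbf{z}},b_{\mathbf{z}}]^2$.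
   Context: Markov product: a conditionally independent copy $Y'$ of $Y$ given $\mathbf{X}$ is a random variable such that, for $\mathbb{P}^{\mathbf{X}}$-almost all $\mathbf{x} \in \mathbb{R}^p$, the conditional distribution of $Y'$ given $\mathbf{X}=\mathbf{x}$ equals that of $Y$ given $\mathbf{X}=\mathbf{x}$, and $Y$ and $Y'$ are conditionally independent given $\mathbf{X}$. The pair $(Y,Y')$ is the Markov product of $(\mathbf{X},Y)$, and correspondingly $(F_Y(Y),F_Y(Y'))$ is the Markov product of $(\mathbf{X},F_Y(Y))$. Notation: $\mathbb{P}^Z$ denotes the distribution of $Z$, and $\mathbb{P}^{Y|\mathbf{X}=\mathbf{x}}$ the (regular) conditional distribution of $Y$ given $\mathbf{X}=\mathbf{x}$. Non-degenerate means not almost surely constant. $\lambda$ denotes Lebesgue measure. Relative effect: for real random variables $Z_1, Z_2$, $$\Psi(\mathbb{P}^{Z_1},\mathbb{P}^{Z_2}) := \int_{\mathbb{R}} \Big(\mathbb{P}(Z_1 < z) + \tfrac12 \mathbb{P}(Z_1 = z)\Big) \, d\mathbb{P}^{Z_2}(z).$$ Coefficient of separation: for $Y$ and at least one coordinate of $\mathbf{X}$ non-degenerate, $$\Lambda(Y|\mathbf{X}) := \frac{4}{1-\mathbb{P}(\mathbf{X}=\mathbf{X}^\ast)} \int_{\mathbb{R}^p\times\mathbb{R}^p} \Big(\Psi\big(\mathbb{P}^{Y|\mathbf{X}=\mathbf{x}_1},\mathbb{P}^{Y|\mathbf{X}=\mathbf{x}_2}\big) - \tfrac12\Big)^2 \,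 d(\mathbb{P}^{\mathbf{X}}\otimes\mathbb{P}^{\mathbf{X}})(\mathbf{x}_1,\mathbf{x}_2),$$ where $\mathbf{X}^\ast$ is an independent copy of $\mathbf{X}$. Complete separation: $Y$ is completely separated relative to $\mathbf{X}$ if $\Psi\big(\mathbb{P}^{Y|\mathbf{X}=\mathbf{x}_1},\mathbb{P}^{Y|\mathbf{X}=\mathbf{x}_2}\big) \in \{0,1\}$ for ($\mathbb{P}^{\mathbf{X}}\otimes\mathbb{P}^{\mathbf{X}}$-)almost all $(\mathbf{x}_1,\mathbf{x}_2)$ with $\mathbf{x}_1 \neq \mathbf{x}_2$. Ordinal sum: let $N$ be a finite (possibly empty) or countably infinite index set, let $\{(a_k,b_k]\}_{k\in N}$ be a family of non-overlapping (pairwise disjoint) subintervals of $[0,1]$ with $0 \leq a_k < b_k \leq 1$, and let $(F_k)_{k\in N}$ be 2-dimensional distribution functions, each $F_k$ having support in $(a_k,b_k]^2$, meaning that the probability measure with distribution function $F_k$ assigns mass $1$ to $(a_k,b_k]^2$. The ordinal sum $F = (\langle (a_k,b_k], F_k\rangle)_{k\in N}$ of size $|N|$ is defined for $(u,v)\in[0,1]^2$ by $$F(u,v) := \sum_{k\in N} (b_k-a_k)\,F_k(u,v) + \lambda\Big([0,\min\{u,v\}] \setminus \bigcup_{k\in N}(a_k,b_k]\Big).$$ A random vector with values in $[0,1]^2$ admits an ordinal sum structure $(\langle (a_k,b_k], F_k\rangle)_{k\in N}$ if its joint distribution function equals this $F$ on $[0,1]^2$. *)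

(* Defs.v *)
From HB Require Import structures.
From mathcomp Require Import all_boot all_order all_algebra.
From mathcomp Require Import all_classical all_reals all_analysis.

Set Implicit Arguments.
Unset Strict Implicit.
Unset Printing Implicit Defensive.

Import Order.TTheory GRing.Theory Num.Theory.
Import numFieldNormedType.Exports.

Local Open Scope classical_set_scope.
Local Open Scope ring_scope.

Definition not_as_constant d (T : measurableType d) (R : realType)
    (P : probability T R) (Z : T -> R) : Prop :=
  ~ exists c : R, {ae P, forall w, Z w = c}.

(* [k] is a version of the regular conditional distribution of [Y] given [X]. *)
Definition cond_distribution d dX (T : measurableType d)
    (TX : measurableType dX) (R : realType) (P : probability T R)
    (X : {RV P >-> TX}) (Y : {RV P >-> R}) (k : R.-pker TX ~> R) : Prop :=
  forall (A : set TX) (B : set R), measurable A -> measurable B ->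
    (P (X @^-1` A `&` Y @^-1` B)
      = \int[distribution P X]_(x in A) k x B)%E.

(* P(Y \in B, Y' \in C | X) = P(Y \in B | X) P(Y' \in C | X) almost surely,    *)
(* tested on the events [X \in A].                                           *)
Definition cond_independent d dX (T : measurableType d)
    (TX : measurableType dX) (R : realType) (P : probability T R)
    (X : {RV P >-> TX}) (Y Y' : {RV P >-> R}) : Prop :=
  exists k k' : R.-pker TX ~> R,
    [/\ cond_distribution X Y k, cond_distribution X Y' k' &
      forall (A : set TX) (B C : set R),
        measurable A -> measurable B -> measurable C ->
        (P (X @^-1` A `&` (Y @^-1` B `&` Y' @^-1` C))
          = \int[distribution P X]_(x in A) (k x B * k' x C))%E].

Definition cond_independent_copy d dX (T : measurableType d)
    (TX : measurableType dX) (R : realType) (P : probability T R)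
    (X : {RV P >-> TX}) (Y Y' : {RV P >-> R}) : Prop :=
  (exists k k' : R.-pker TX ~> R,
    [/\ cond_distribution X Y k, cond_distribution X Y' k' &
      {ae distribution P X, forall x,
        forall B : set R, measurable B -> k x B = k' x B}])
  /\ cond_independent X Y Y'.

Definition relative_effect (R : realType)
    (mu nu : {measure set R -> \bar R}) : R :=
  \int[nu]_z (fine (mu `]-oo, z[%classic) + 2^-1 * fine (mu [set z])).

(* The law of (X, X^* ), with X^* an independent copy of X, is the product of  *)
(* the law of X with itself, so P(X = X^* ) is its value on the diagonal.      *)
Definition separation_coef d dX (T : measurableType d)
    (TX : measurableType dX) (R : realType) (P : probability T R)
    (X : {RV P >-> TX}) (k : R.-pker TX ~> R) : R :=
  let PXX := (distribution P X \x distribution P X)%E in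
  4 / (1 - fine (PXX [set x | x.1 = x.2]))
    * \int[PXX]_x (relative_effect (k x.1) (k x.2) - 2^-1) ^+ 2.

Definition completely_separated d dX (T : measurableType d)
    (TX : measurableType dX) (R : realType) (P : probability T R)
    (X : {RV P >-> TX}) (k : R.-pker TX ~> R) : Prop :=
  {ae (distribution P X \x distribution P X)%E, forall x, x.1 <> x.2 ->
    relative_effect (k x.1) (k x.2) = 0 \/ relative_effect (k x.1) (k x.2) = 1}.

Definition distr_fun d (T : measurableType d) (R : realType)
    (P : probability T R) (Y : {RV P >-> R}) (y : R) : R := fine (cdf Y y).

Definition joint_cdf d (T : measurableType d) (R : realType)
    (P : probability T R) (U V : T -> R) (u v : R) : \bar R :=
  P [set w | U w <= u /\ V w <= v].

Definition cdf2_supported (R : realType) (a b : R) (F : R -> R -> R) : Prop :=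
  exists mu : probability (R * R)%type R,
    (forall u v : R, (F u v)%:E = mu (`]-oo, u]%classic `*` `]-oo, v]%classic)) /\
    mu (`]a, b]%classic `*` `]a, b]%classic) = 1%E.

Definition ordinal_sum_data (R : realType) (I : choiceType) (N : set I)
    (a b : I -> R) (F : I -> R -> R -> R) : Prop :=
  [/\ countable N,
      forall k, N k -> 0 <= a k /\ a k < b k /\ b k <= 1,
      trivIset N (fun k => `]a k, b k]%classic) &
      forall k, N k -> cdf2_supported (a k) (b k) (F k)].

Definition ordinal_sum (R : realType) (I : choiceType) (N : set I)
    (a b : I -> R) (F : I -> R -> R -> R) (u v : R) : \bar R :=
  (\esum_(k in N) ((b k - a k) * F k u v)%:E
    + lebesgue_measure
        (`[0%R, Num.min u v]%classic `\` \bigcup_(k in N) `]a k, b k]%classic))%E.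

Definition admits_ordinal_sum d (T : measurableType d) (R : realType)
    (P : probability T R) (U V : T -> R) (I : choiceType) (N : set I)
    (a b : I -> R) (F : I -> R -> R -> R) : Prop :=
  ordinal_sum_data N a b F /\
  forall u v : R, 0 <= u <= 1 -> 0 <= v <= 1 ->
    joint_cdf P U V u v = ordinal_sum N a b F u v.

(* Main.v *)
Require Import Defs.
From HB Require Import structures.
From mathcomp Require Import all_boot all_order all_algebra.
From mathcomp Require Import all_classical all_reals all_analysis.
From mathcomp Require Import measurable_realfun ring lra.

(** Write [rho] for the law of [X], [k x] for the conditional law of [Y] given
    [X = x], [V = F_Y(Y)], [V' = F_Y(Y')], [p z = rho {z}] for the atoms [z] of
    [rho], and [Psi] for the relative effect. The conditional independence of
    [Y] and [Y'] enters only through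
    [P(V <= u, V' <= v) = \int k x {F_Y <= u} * k x {F_Y <= v} rho(dx)].

    (a) <-> (b). On the diagonal [Psi = 1/2], and off the diagonal
    [1/4 - (Psi - 1/2)^2 = Psi (1 - Psi) >= 0]; hence the coefficient is [1]
    exactly when [Psi (1 - Psi)] vanishes almost everywhere off the diagonal
    ([separation_coef_eq1]). The normalisation is legitimate because [X] is not
    almost surely constant ([product_diag_lt1]).

    (b) -> (c). [Psi(mu, nu) = 1] forces every lower half-line either to have full
    mass for [mu] or to be null for [nu] ([precedes]). So complete separation
    orders almost all the laws [k x] linearly, and the block of an atom [z] is
    [(a_z, b_z]] with [a_z] the mass of the [x] whose law precedes [k z] and
    [b_z = a_z + p z]. Given [X = z], [V] lies in that block
    ([kernel_lev_low], [kernel_lev_high]), and conditional independence makes the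
    law of [(V, V')] on the block a product. Two distinct [x] whose laws are both
    split by a half-line are not separated, so away from the atoms a level
    [{F_Y <= u}] has conditional probability [0] or [1] ([nonatom_down_set]):
    there [V] and [V'] lie below [u] simultaneously. It remains to see that the
    part of [V] that does not come from the atoms is Lebesgue measure outside the
    blocks ([nonatom_lev]). For [u] not inside a block [P(V <= u) = u]
    ([mixture_lev]): a jump of [F_Y] over [u] would be an atom of [Y], which must
    come from an atom [z] of [X] whose block then surrounds [u].

    (c) -> (b). For a level [u] not inside a block the ordinal sum gives
    [P(V <= u, V' <= u) = P(V <= u) = u], so [k x {F_Y <= u}] and its square have
    the same integral and [k x {F_Y <= u}] is [0] or [1] for almost every [x].
    Two points [x], [y] on different sides of such a cut have [Psi] in [{0, 1}].
    For the others, let [A z] be the set of [x] whose law puts [V] in the block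
    of [z], a set of mass [p z]. A point outside every [A z] shares its side with
    only a null set ([xsectionN]). Consequently every atom of [X] lies in some
    [A z], so that the union of the squares [A z * A z] contains the union of the
    squares [{z} * {z}]; both have product measure [\sum_z (p z)^2], so almost all
    pairs in the first union have equal entries ([ordinal_sum_separates]). *)

Set Implicit Arguments.
Unset Strict Implicit.
Unset Printing Implicit Defensive.

Import Order.TTheory GRing.Theory Num.Theory.
Import numFieldNormedType.Exports.

Local Open Scope classical_set_scope.
Local Open Scope ring_scope.

(** * Countable families, atoms and down-sets *)

Lemma countable_setU (T : Type) (A B : set T) :
  countable A -> countable B -> countable (A `|` B).
Proof.
move=> cA cB; rewrite -bigcup2E; apply: bigcup_countable => // i _.
by rewrite /bigcup2; case: i => [|[|i]] //=; exact: countable0.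
Qed.

(** Sigma-additivity speaks of sequences, whereas the atoms of a law come as a
    countable set of points; [B j] is [A i] for the only [i] numbered [j], if any. *)
Lemma countable_bigcup_nat (I T : Type) (N : set I) (A : I -> set T) :
  countable N -> exists (f : I -> nat) (B : nat -> set T),
    [/\ {in N &, injective f}, forall i, N i -> B (f i) = A i,
        forall j, ~ (f @` N) j -> B j = set0 &
        \bigcup_(i in N) A i = \bigcup_j B j].
Proof.
move=> /countable_injP[f injf].
pose B j := \bigcup_(i in N `&` f @^-1` [set j]) A i.
exists f, B; have Bf i : N i -> B (f i) = A i.
  move=> Ni; apply/seteqP; split => [x [i' [Ni' /= fi'] Ax]|x Ax].
    by rewrite -(injf _ _ _ _ fi') ?inE.
  by exists i.
split => //.
  move=> j Nj; apply/seteqP; split => // x [i [Ni fi] _].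
  by apply: Nj; exists i.
apply/seteqP; split => [x [i Ni Ax]|x [j _ [i [Ni _] Ax]]]; last by exists i.
by exists (f i) => //; rewrite Bf.
Qed.

Lemma measurable_countable_bigcup d (T : measurableType d) (I : Type)
    (N : set I) (A : I -> set T) :
  countable N -> (forall i, N i -> measurable (A i)) ->
  measurable (\bigcup_(i in N) A i).
Proof.
move=> /(countable_bigcup_nat A)[f [B [_ Bf B0 ->]]] mA.
apply: bigcup_measurable => j _.
have [[i Ni <-]|/B0 ->] := pselect ((f @` N) j); last exact: measurable0.
by rewrite Bf//; exact: mA.
Qed.

(** The set function is arbitrary so that the lemma serves both for measures and
    for integrals [A |-> \int_A f]. *)
Lemma countable_bigcup_additive d (T : measurableType d) (R : realType)
    (phi : set T -> \bar R) (I : choiceType) (N : set I) (A : I -> set T) :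
  (forall B, 0 <= phi B)%E -> phi set0 = 0%E ->
  (forall B : (set T)^nat, (forall n, measurable (B n)) -> trivIset setT B ->
    phi (\bigcup_n B n) = \sum_(n <oo) phi (B n))%E ->
  countable N -> (forall i, N i -> measurable (A i)) -> trivIset N A ->
  (phi (\bigcup_(i in N) A i) = \esum_(i in N) phi (A i))%E.
Proof.
move=> phi_ge0 phi0 phi_add /(countable_bigcup_nat A) + mA tA.
move=> [f [B [injf Bf B0 ->]]]; rewrite phi_add; last 2 first.
- move=> j; have [[i Ni <-]|/B0 ->] := pselect ((f @` N) j); last exact: measurable0.
  by rewrite Bf//; exact: mA.
- move=> j j' _ _ [x []].
  have [[i Ni <-]|/B0 -> //] := pselect ((f @` N) j).
  have [[i' Ni' <-]|/B0 -> //] := pselect ((f @` N) j').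
  by rewrite !Bf// => Ax Ax'; congr f; apply: tA => //; exists x.
rewrite nneseries_esumT// [LHS](_ : _ = \esum_(j in f @` N) phi (B j))%E.
  rewrite (reindex_esum _ _ _ _ (inj_bij injf)).
  by apply: eq_esum => i Ni; rewrite Bf.
rewrite [RHS]esum_mkcond; apply: eq_esum => j _.
have [//|/negP] := boolP (j \in f @` N).
by rewrite inE => /B0 ->.
Qed.

Lemma measure_countable_bigcup d (T : measurableType d) (R : realType)
    (mu : {measure set T -> \bar R}) (I : choiceType) (N : set I)
    (A : I -> set T) :
  countable N -> (forall i, N i -> measurable (A i)) -> trivIset N A ->
  (mu (\bigcup_(i in N) A i) = \esum_(i in N) mu (A i))%E.
Proof.
apply: countable_bigcup_additive => // B mB tB.
by apply: measure_semi_bigcup => //; exact: bigcup_measurable.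
Qed.

Lemma integral_atoms d (T : measurableType d) (R : realType)
    (mu : {measure set T -> \bar R}) (N : set T) (f : T -> \bar R) :
  (forall z : T, measurable [set z]) -> countable N ->
  (forall x, 0 <= f x)%E -> measurable_fun setT f ->
  (\int[mu]_(x in N) f x = \esum_(z in N) (mu [set z] * f z))%E.
Proof.
move=> mset1 cN f0 mf.
have NE : N = \bigcup_(z in N) [set z] by rewrite bigcup_imset1 image_id.
rewrite [X in (\int[mu]_(x in X) f x)%E]NE.
rewrite (@countable_bigcup_additive _ _ _ (fun A => \int[mu]_(x in A) f x)%E)//.
- apply: eq_esum => z _; rewrite -[RHS]muleC -integral_cst//.
  by apply: eq_integral => x; rewrite inE => /= ->.
- by move=> B; exact: integral_ge0.
- by rewrite integral_set0.
- move=> B mB tB; rewrite ge0_integral_bigcup//.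
  exact: measurable_funS mf.
- by move=> i j _ _ [x [-> ->]].
Qed.

(** At most [n] points can carry mass above [1 / (n + 1)], since [n + 1] of them
    would exceed the total mass. *)
Lemma countable_atoms d (T : measurableType d) (R : realType)
    (P : probability T R) :
  (forall z : T, measurable [set z]) ->
  countable [set z | (0 < P [set z])%E].
Proof.
move=> m1.
have -> : [set z | (0 < P [set z])%E] =
    \bigcup_n [set z | n.+1%:R^-1 < fine (P [set z])].
  apply/seteqP; split=> [z/=|z/= [n _] h].
    rewrite -[P _]fineK ?fin_num_measure//= lte_fin.
    by move=> /ltr_add_invr[n /[!add0r] h]; exists n.
  by rewrite -[P _]fineK ?fin_num_measure// lte_fin; exact: lt_trans h.
apply: bigcup_countable => // n _; apply: finite_set_countable.
apply: contrapT => /infiniteP/pcard_leP/injfunPex[/= q q_fun q_inj].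
have /(probability_le1 P) : measurable (\bigcup_k [set q k]).
  exact: bigcup_measurable.
rewrite leNgt => /negP; apply.
rewrite measure_countable_bigcup//; last 2 first.
  exact: countableP.
  by move=> i j _ _ [x [/= -> /q_inj ->]]; rewrite ?inE.
rewrite -nneseries_esumT//.
apply: (lt_le_trans _ (nneseries_lim_ge n.+1 _)) => //.
rewrite -EFin_sum_fine//; last by move=> ? _; rewrite fin_num_measure.
rewrite lte_fin (_ : 1%R = (\sum_(0 <= k < n.+1) n.+1%:R^-1:R)%R); last first.
  by rewrite sumr_const_nat subn0 -[RHS]mulr_natr mulVf.
by apply: ltr_sum => // k _; exact: q_fun.
Qed.

Lemma ae_countable d (T : measurableType d) (R : realType)
    (mu : {measure set T -> \bar R}) (I : choiceType) (N : set I)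
    (Q : I -> T -> Prop) :
  countable N -> (forall i, N i -> {ae mu, forall x, Q i x}) ->
  {ae mu, forall x, forall i, N i -> Q i x}.
Proof.
move=> /countable_injP[f injf] aeQ.
have := @ae_foralln _ _ _ mu (fun n x => forall i, N i -> f i = n -> Q i x).
have h n : \forall x \ae mu, forall i, N i -> f i = n -> Q i x.
  have [[i [Ni fi]]|no] := pselect (exists i, N i /\ f i = n); last first.
    by apply: aeW => x i Ni fi; exfalso; apply: no; exists i.
  have := aeQ i Ni; apply: filterS => x Qx j Nj fj.
  suff -> : j = i by [].
  by apply: injf; rewrite ?inE// fi fj.
move=> /(_ h); apply: filterS => x Qx i Ni; exact: Qx erefl.
Qed.

(** A finite union taken from a chain is a member of the chain, so that
    continuity from below applies. *)
Lemma measure_chain_bigcup_le d (T : measurableType d) (R : realType)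
    (mu : {measure set T -> \bar R}) (A : (set T)^nat) (u : \bar R) :
  (forall n, measurable (A n)) ->
  (forall m n, A m `<=` A n \/ A n `<=` A m) ->
  (forall n, mu (A n) <= u)%E -> (mu (\bigcup_n A n) <= u)%E.
Proof.
move=> mA chA leu.
pose B n := \big[setU/set0]_(i < n.+1) A i.
have BA n : exists j, B n = A j.
  rewrite /B; elim: n => [|n [j IH]].
    by exists 0%N; rewrite big_ord_recl big_ord0 setU0.
  rewrite big_ord_recr/= IH.
  by have [/setUidPr ->|/setUidPl ->] := chA j n.+1; [exists n.+1|exists j].
have mB n : measurable (B n) by have [j ->] := BA n.
rewrite (_ : \bigcup_n A n = \bigcup_n B n); last first.
  apply/seteqP; split => [x [n _ Ax]|x [n _]].
    by exists n => //; rewrite /B big_ord_recr/=; right.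
  by rewrite /B -bigcup_mkord => -[i _ Ax]; exists i.
have ndB : nondecreasing_seq B.
  apply/nondecreasing_seqP => n; apply/subsetPset.
  by rewrite /B [X in _ `<=` X]big_ord_recr/=; exact: subsetUl.
have cvB := nondecreasing_cvg_mu (mu := mu) mB (bigcup_measurable (fun n _ => mB n)) ndB.
rewrite -(cvg_lim _ cvB)//; apply: lime_le; first by apply/cvg_ex; exists (mu (\bigcup_n B n)).
by apply: nearW => n /=; have [j ->] := BA n.
Qed.

Section down_sets.
Context {R : realType} (mu : {measure set R -> \bar R}).

Definition down_set (D : set R) := forall x y, D y -> x <= y -> D x.

Lemma down_set_measurable (D : set R) : down_set D -> measurable D.
Proof.
by move=> dD; apply: is_interval_measurable => x y Dx Dy z /andP[_ zy]; exact: dD zy.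
Qed.

Let rat_seq (B : rat -> set R) n :=
  if unpickle n is Some q then B q else set0.

Let bigcup_rat_seq B : \bigcup_n rat_seq B n = \bigcup_q B q.
Proof.
apply/seteqP; split => [x [n _]|x [q _ Bx]].
  by rewrite /rat_seq; case: unpickle => // q Bx; exists q.
by exists (pickle q); [exact: I|rewrite /rat_seq pickleK].
Qed.

(** A down-set without maximum is the union of the half-lines below its rational
    elements. Two uses: [u = 0] says that [mu]-almost every [y] is reached by [mu]
    from below, and for [D = {F_Y <= u}] with [mu] the law of [Y] one gets
    [P(F_Y(Y) <= u) <= u]. *)
Lemma measure_down_set_le (D : set R) (u : \bar R) : down_set D -> (0 <= u)%E ->
  (forall y, D y -> (mu `]-oo, y]%classic <= u)%E) -> (mu D <= u)%E.
Proof.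
move=> dD u0 leu.
have [[m [Dm maxm]]|nomax] := pselect (exists m, D m /\ forall y, D y -> y <= m).
  rewrite (_ : D = `]-oo, m]%classic); first exact: leu.
  by apply/seteqP; split => y /=; rewrite in_itv/=; [exact: maxm|exact: dD].
pose B (q : rat) : set R :=
  if pselect (D (ratr q)) then `]-oo, ratr q]%classic else set0.
rewrite (_ : D = \bigcup_q B q); last first.
  apply/seteqP; split => [y Dy|y [q _]]; last first.
    rewrite /B; case: pselect => // Dq /=; rewrite in_itv/=; exact: dD.
  have [y' Dy' yy'] : exists2 y', D y' & y < y'.
    apply: contrapT => no; apply: nomax; exists y; split => // z Dz.
    by rewrite leNgt; apply/negP => yz; apply: no; exists z.
  have [q] := rat_in_itvoo yy'; rewrite inE/= => /andP[yq qy'].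
  exists q => //; rewrite /B; case: pselect => [_ /=|[]].
    by rewrite in_itv/= ltW.
  exact: dD (ltW qy').
rewrite -bigcup_rat_seq; apply: measure_chain_bigcup_le => [n|m n|n].
- rewrite /rat_seq; case: (unpickle _) => [q|]; last exact: measurable0.
  by rewrite /B; case: pselect => ?; [exact: measurable_itv|exact: measurable0].
- rewrite /rat_seq; case: (unpickle _) => [q|]; last by left.
  case: (unpickle _) => [q'|]; last by right.
  rewrite /B; case: pselect => Dq; last by left.
  case: pselect => Dq'; last by right.
  by have [qq'|/ltW qq'] := leP (ratr q : R) (ratr q'); [left|right];
    apply: subset_itvl; rewrite bnd_simp.
- rewrite /rat_seq; case: (unpickle _) => [q|]; last by rewrite measure0.
  by rewrite /B; case: pselect => Dq; [exact: leu|rewrite measure0].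
Qed.

Lemma measure_setC_down_set_le (D : set R) (u : \bar R) : down_set D -> (0 <= u)%E ->
  (forall y, ~ D y -> (mu `[y, +oo[%classic <= u)%E) -> (mu (~` D) <= u)%E.
Proof.
move=> dD u0 leu.
have uD x y : ~ D y -> y <= x -> ~ D x by move=> Dy yx Dx; apply: Dy; exact: dD yx.
have [[m [Dm minm]]|nomin] :=
    pselect (exists m, ~ D m /\ forall y, ~ D y -> m <= y).
  rewrite (_ : ~` D = `[m, +oo[%classic); first exact: leu.
  by apply/seteqP; split => y /=; rewrite in_itv/= andbT; [exact: minm|exact: uD].
pose B (q : rat) : set R :=
  if pselect (D (ratr q)) then set0 else `[ratr q, +oo[%classic.
rewrite (_ : ~` D = \bigcup_q B q); last first.
  apply/seteqP; split => [y Dy|y [q _]]; last first.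
    by rewrite /B; case: pselect => // Dq /=; rewrite in_itv/= andbT; exact: uD.
  have [y' Dy' yy'] : exists2 y', ~ D y' & y' < y.
    apply: contrapT => no; apply: nomin; exists y; split => // z Dz.
    by rewrite leNgt; apply/negP => yz; apply: no; exists z.
  have [q] := rat_in_itvoo yy'; rewrite inE/= => /andP[yq qy'].
  exists q => //; rewrite /B; case: pselect => [Dq|_ /=].
    by exfalso; exact: (uD (ratr q) y') (ltW yq) Dq.
  by rewrite in_itv/= andbT ltW.
rewrite -bigcup_rat_seq; apply: measure_chain_bigcup_le => [n|m n|n].
- rewrite /rat_seq; case: (unpickle _) => [q|]; last exact: measurable0.
  by rewrite /B; case: pselect => ?; [exact: measurable0|exact: measurable_itv].
- rewrite /rat_seq; case: (unpickle _) => [q|]; last by left.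
  case: (unpickle _) => [q'|]; last by right.
  rewrite /B; case: pselect => Dq; first by left.
  case: pselect => Dq'; first by right.
  by have [qq'|/ltW qq'] := leP (ratr q : R) (ratr q'); [right|left];
    apply: subset_itvr; rewrite bnd_simp.
- rewrite /rat_seq; case: (unpickle _) => [q|]; last by rewrite measure0.
  by rewrite /B; case: pselect => Dq; [rewrite measure0|exact: leu].
Qed.

End down_sets.

(** * Relative effect of two probability laws *)

Section fine_probability.
Context d (T : measurableType d) (R : realType) (P : probability T R).
Implicit Types A B : set T.

Lemma EFin_fine_probability A : measurable A -> (fine (P A))%:E = P A.
Proof. by move=> mA; rewrite fineK// fin_num_measure. Qed.

Lemma fine_probability_le1 A : measurable A -> fine (P A) <= 1.
Proof.
by move=> mA; rewrite -lee_fin EFin_fine_probability// probability_le1.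
Qed.

Lemma fine_probabilityT : fine (P setT) = 1.
Proof. by rewrite [P setT](@probability_setT _ _ _ P). Qed.

Lemma le_fine_probability A B : measurable A -> measurable B -> A `<=` B ->
  fine (P A) <= fine (P B).
Proof.
move=> mA mB AB; apply: fine_le; rewrite ?fin_num_measure//.
by apply: le_measure; rewrite ?inE.
Qed.

Lemma fine_probabilityU A B : measurable A -> measurable B ->
  A `&` B = set0 -> fine (P (A `|` B)) = fine (P A) + fine (P B).
Proof.
by move=> mA mB AB; rewrite measureU// fineD ?fin_num_measure.
Qed.

Lemma fine_probabilityC A : measurable A -> fine (P (~` A)) = 1 - fine (P A).
Proof.
by move=> mA; rewrite probability_setC// fineB ?fin_num_measure.
Qed.

Lemma probability_bounded_integrable (f : T -> R) (M : R) :
  measurable_fun setT f -> (forall x, `|f x| <= M) ->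
  P.-integrable setT (EFin \o f).
Proof.
move=> mf bf; apply: measurable_bounded_integrable => //.
  by rewrite (le_lt_trans (probability_le1 P measurableT))// ltry.
exists M; split; first by rewrite num_real.
by move=> y My x _; rewrite /= (le_trans (bf x))// ltW.
Qed.

End fine_probability.

Section relative_effect.
Context {R : realType}.
Implicit Types mu nu : probability R R.

Definition mid_cdf mu (z : R) : R :=
  fine (mu `]-oo, z[%classic) + 2^-1 * fine (mu [set z]).

Lemma mid_cdfE mu z : mid_cdf mu z =
  2^-1 * (fine (mu `]-oo, z[%classic) + fine (mu `]-oo, z]%classic)).
Proof.
rewrite /mid_cdf -(@setUitv1 _ _ -oo%O z true)// fine_probabilityU//; last first.
  by apply/seteqP; split => // x [/=]; rewrite in_itv/= => /[swap] ->; rewrite ltxx.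
lra.
Qed.

Lemma mid_cdf_ge0 mu z : 0 <= mid_cdf mu z.
Proof. by rewrite /mid_cdf addr_ge0// ?mulr_ge0// fine_ge0. Qed.

Lemma mid_cdf_upper mu z : 1 - mid_cdf mu z =
  2^-1 * (fine (mu `]z, +oo[%classic) + fine (mu `[z, +oo[%classic)).
Proof.
have := fine_probabilityC mu (measurable_itv `]-oo, z[).
have := fine_probabilityC mu (measurable_itv `]-oo, z]).
rewrite setCitvl setCitvl /= mid_cdfE => -> ->.
lra.
Qed.

Lemma mid_cdf_le1 mu z : mid_cdf mu z <= 1.
Proof.
by rewrite -subr_ge0 mid_cdf_upper mulr_ge0// addr_ge0// fine_ge0.
Qed.

Lemma measurable_mid_cdf mu : measurable_fun setT (mid_cdf mu).
Proof.
apply: nondecreasing_measurable => // x y xy; rewrite !mid_cdfE.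
rewrite ler_pM2l// lerD// le_fine_probability//; apply: subset_itvl;
  by rewrite bnd_simp.
Qed.

Lemma integrable_mid_cdf mu nu : nu.-integrable setT (EFin \o mid_cdf mu).
Proof.
apply: (@probability_bounded_integrable _ _ _ _ _ 1).
  exact: measurable_mid_cdf.
by move=> z; rewrite ger0_norm ?mid_cdf_ge0 ?mid_cdf_le1.
Qed.

Lemma relative_effect_ge mu nu (A : set R) (c : R) : measurable A ->
  (forall z, A z -> c <= mid_cdf mu z) -> 
  c * fine (nu A) <= relative_effect mu nu.
Proof.
move=> mA cA.
have -> : c * fine (nu A) = \int[nu]_z (c * \1_A z).
  rewrite RintegralZl//; last exact: integrable_indic.
  by rewrite /Rintegral integral_indic// setIT.
apply: le_Rintegral => //.
- apply: (@probability_bounded_integrable _ _ _ _ _ `|c|).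
    by apply: measurable_funM => //; exact: measurable_indic.
  by move=> z; rewrite normrM indicE; case: (_ \in _); rewrite ?normr1 ?normr0 ?mulr1 ?mulr0.
- exact: integrable_mid_cdf.
- move=> z _; rewrite indicE; have [/set_mem zA|_] := boolP (z \in A).
    by rewrite mulr1; exact: cA.
  by rewrite mulr0 mid_cdf_ge0.
Qed.

Lemma relative_effect_le mu nu (A : set R) (c : R) : measurable A ->
  (forall z, A z -> c <= 1 - mid_cdf mu z) ->
  relative_effect mu nu <= 1 - c * fine (nu A).
Proof.
move=> mA cA.
have -> : 1 - c * fine (nu A) = \int[nu]_z (1 - c * \1_A z).
  rewrite RintegralB//; last 2 first.
  - exact: finite_measure_integrable_cst.
  - apply: (@probability_bounded_integrable _ _ _ _ _ `|c|).
      by apply: measurable_funM => //; exact: measurable_indic.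
    by move=> z; rewrite normrM indicE; case: (_ \in _); rewrite ?normr1 ?normr0 ?mulr1 ?mulr0.
  rewrite RintegralZl//; last exact: integrable_indic.
  rewrite Rintegral_cst// fine_probabilityT mulr1.
  by rewrite /Rintegral integral_indic// setIT.
apply: le_Rintegral => //.
- exact: integrable_mid_cdf.
- apply: (@probability_bounded_integrable _ _ _ _ _ (1 + `|c|)).
    by apply: measurable_funB => //; apply: measurable_funM => //; exact: measurable_indic.
  move=> z; rewrite (le_trans (ler_normB _ _))// normr1 lerD2l.
  by rewrite normrM indicE; case: (_ \in _); rewrite ?normr1 ?normr0 ?mulr1 ?mulr0.
- move=> z _; rewrite indicE lerBrDl -lerBrDr; have [/set_mem zA|_] := boolP (z \in A).
    by rewrite mulr1; exact: cA.
  by rewrite mulr0 subr_ge0 mid_cdf_le1.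
Qed.

Lemma relative_effect_ge0 mu nu : 0 <= relative_effect mu nu.
Proof. by apply: Rintegral_ge0 => z _; exact: mid_cdf_ge0. Qed.

Lemma relative_effect_le1 mu nu : relative_effect mu nu <= 1.
Proof.
have := @relative_effect_le mu nu set0 0 measurable0.
by rewrite mul0r subr0; apply.
Qed.

(** For independent [Y1] of law [mu] and [Y2] of law [nu] this is [Y1 < Y2] almost
    surely: no level [y] has both [Y1 >= y] and [Y2 <= y] with positive
    probability. This form avoids the product measure. *)
Definition precedes mu nu := forall y : R,
  fine (mu `[y, +oo[%classic) = 0 \/ fine (nu `]-oo, y]%classic) = 0.

(** On [[y, +oo[] the integrand is at least half of [mu ]-oo, y]]; if [nu] charged
    that half-line and [mu] the lower one, the integral would be positive. *)
Lemma relative_effect0_precedes mu nu :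
  relative_effect mu nu = 0 -> precedes nu mu.
Proof.
move=> re0 y.
have := @relative_effect_ge mu nu `[y, +oo[%classic
  (2^-1 * fine (mu `]-oo, y]%classic)) (measurable_itv _).
rewrite re0 => h.
suff : fine (mu `]-oo, y]%classic) * fine (nu `[y, +oo[%classic) <= 0.
  rewrite le_eqVlt ltNge mulr_ge0 ?fine_ge0// orbF mulf_eq0.
  by move=> /orP[/eqP ->|/eqP ->]; [right|left].
rewrite -(@pmulr_rle0 _ 2^-1) ?invr_gt0// mulrA; apply: h => z /=.
rewrite in_itv/= andbT => yz; rewrite mid_cdfE ler_pM2l//.
by rewrite ler_wpDl ?fine_ge0// le_fine_probability//; apply: subset_itvl.
Qed.

Lemma relative_effect1_precedes mu nu :
  relative_effect mu nu = 1 -> precedes mu nu.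
Proof.
move=> re1 y.
have := @relative_effect_le mu nu `]-oo, y]%classic
  (2^-1 * fine (mu `[y, +oo[%classic)) (measurable_itv _).
rewrite re1 => h.
suff : fine (mu `[y, +oo[%classic) * fine (nu `]-oo, y]%classic) <= 0.
  rewrite le_eqVlt ltNge mulr_ge0 ?fine_ge0// orbF mulf_eq0.
  by move=> /orP[/eqP ->|/eqP ->]; [left|right].
rewrite -(@pmulr_rle0 _ 2^-1) ?invr_gt0// mulrA.
rewrite -subr_ge0 sub0r -(lerD2l 1) addr0; apply: h => z /=.
rewrite in_itv/= => yz; rewrite mid_cdf_upper ler_pM2l//.
by rewrite ler_wpDl ?fine_ge0// le_fine_probability//; apply: subset_itvr.
Qed.

Lemma relative_effect_separated mu nu (D : set R) : down_set D ->
  fine (mu D) = 1 -> fine (nu D) = 0 ->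
  relative_effect mu nu = 1 /\ relative_effect nu mu = 0.
Proof.
move=> dD muD nuD; have mD := down_set_measurable dD.
split; apply/eqP; rewrite eq_le.
- rewrite relative_effect_le1/=.
  have := @relative_effect_ge mu nu (~` D) 1 (measurableC mD).
  rewrite mul1r fine_probabilityC// nuD subr0; apply => z Dz.
  have h (A : set R) : measurable A -> D `<=` A -> 1 <= fine (mu A).
    by move=> mA DA; rewrite -muD le_fine_probability.
  have Dlt x : D x -> x < z.
    by move=> Dx; rewrite ltNge; apply/negP => zx; apply: Dz; exact: dD zx.
  have h1 : 1 <= fine (mu `]-oo, z[%classic).
    by apply: h => // x Dx /=; rewrite in_itv/= Dlt.
  have h2 : 1 <= fine (mu `]-oo, z]%classic).
    by apply: h => // x Dx /=; rewrite in_itv/= ltW// Dlt.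
  by rewrite mid_cdfE; lra.
- rewrite relative_effect_ge0 andbT.
  have := @relative_effect_le nu mu D 1 mD.
  rewrite mul1r muD subrr; apply => z Dz.
  have h (A : set R) : measurable A -> ~` D `<=` A -> 1 <= fine (nu A).
    move=> mA DA; rewrite -[leLHS]subr0 -nuD -fine_probabilityC//.
    by rewrite le_fine_probability//; exact: measurableC.
  have Dgt x : ~ D x -> z < x.
    by move=> Dx; rewrite ltNge; apply/negP => zx; apply: Dx; exact: dD zx.
  have h1 : 1 <= fine (nu `]z, +oo[%classic).
    by apply: h => // x Dx /=; rewrite in_itv/= andbT Dgt.
  have h2 : 1 <= fine (nu `[z, +oo[%classic).
    by apply: h => // x Dx /=; rewrite in_itv/= andbT ltW// Dgt.
  by rewrite mid_cdf_upper; lra.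
Qed.

(** Both [\int mu ]-oo, z[] and [\int mu ]z, +oo[] are the mass of the half-plane
    [{x < y}] under the square of [mu], computed by its two kinds of sections. *)
Lemma relative_effect_diag mu : relative_effect mu mu = 2^-1.
Proof.
have half : \int[mu]_z (fine (mu `]-oo, z[%classic) : R) =
            \int[mu]_z (fine (mu `]z, +oo[%classic) : R).
  pose A := [set p : R * R | p.1 < p.2].
  have mA : measurable A.
    rewrite -[A]setTI; exact: measurable_fun_ltr.
  rewrite /Rintegral; congr fine.
  transitivity (\int[mu]_z (mu (ysection A z)))%E.
    apply: eq_integral => z _; rewrite EFin_fine_probability//; congr (mu _).
    by apply/seteqP; split => x; rewrite /ysection /= in_itv/= ?inE.
  transitivity (\int[mu]_z (mu (xsection A z)))%E; last first.
    apply: eq_integral => z _; rewrite EFin_fine_probability//; congr (mu _).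
    by apply/seteqP; split => x; rewrite /xsection /= in_itv/= andbT ?inE.
  have := indic_fubini_tonelli mu mu mA.
  by rewrite indic_fubini_tonelli_FE// indic_fubini_tonelli_GE.
have mitv1 : measurable_fun setT (fun z : R => fine (mu `]-oo, z[%classic) : R).
  apply: nondecreasing_measurable => // x y xy.
  by apply: le_fine_probability => //; apply: subset_itvl; rewrite bnd_simp.
have mitv2 : measurable_fun setT (fun z : R => fine (mu `]z, +oo[%classic) : R).
  apply: nonincreasing_measurable => // x y xy.
  by apply: le_fine_probability => //; apply: subset_itvr; rewrite bnd_simp.
have i1 : mu.-integrable setT (EFin \o (fun z => fine (mu `]-oo, z[%classic))).
  apply: (@probability_bounded_integrable _ _ _ _ _ 1) => // z.
  by rewrite ger0_norm ?fine_ge0 ?fine_probability_le1.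
have i2 : mu.-integrable setT (EFin \o (fun z => fine (mu `]z, +oo[%classic))).
  apply: (@probability_bounded_integrable _ _ _ _ _ 1) => // z.
  by rewrite ger0_norm ?fine_ge0 ?fine_probability_le1.
have i12 : mu.-integrable setT
    (EFin \o (fun z => fine (mu `]-oo, z[%classic) + (1 - fine (mu `]z, +oo[%classic)))).
  apply: (@probability_bounded_integrable _ _ _ _ _ 2) => [|z].
    by apply: measurable_funD => //; exact: measurable_funB.
  have := fine_probability_le1 mu (measurable_itv `]-oo, z[).
  have := fine_probability_le1 mu (measurable_itv `]z, +oo[).
  have : 0 <= fine (mu `]z, +oo[%classic) by rewrite fine_ge0.
  have : 0 <= fine (mu `]-oo, z[%classic) by rewrite fine_ge0.
  by move=> *; rewrite ger0_norm; lra.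
have -> : relative_effect mu mu = \int[mu]_z (2^-1 *
    (fine (mu `]-oo, z[%classic) + (1 - fine (mu `]z, +oo[%classic)))).
  apply: eq_Rintegral => z _; rewrite -/(mid_cdf mu z) mid_cdfE.
  by rewrite -fine_probabilityC// setCitvr.
have i3 := finite_measure_integrable_cst mu (1 : R) measurableT.
rewrite RintegralZl// RintegralD//; last first.
  apply: (@probability_bounded_integrable _ _ _ _ _ 1) => [|z].
    exact: measurable_funB.
  have := fine_probability_le1 mu (measurable_itv `]z, +oo[).
  have : 0 <= fine (mu `]z, +oo[%classic) by rewrite fine_ge0.
  by move=> *; rewrite ger0_norm; lra.
by rewrite RintegralB// half Rintegral_cst// fine_probabilityT; lra.
Qed.

End relative_effect.

(** * Measurability of the relative effect along a kernel *)

Section mass_one.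
Context d (T : measurableType d) (R : realType) (mu : {measure set T -> \bar R}).

(** Gives a value of a probability kernel, which is only a measure, the structure
    of a probability. *)
Definition mass_one_probability of mu setT = 1%E : set T -> \bar R := mu.

Variable mu1 : mu setT = 1%E.

HB.instance Definition _ := isMeasure.Build _ _ _ (mass_one_probability mu1)
  (measure0 mu) (measure_ge0 mu) (@measure_semi_sigma_additive _ _ _ mu).

HB.instance Definition _ :=
  Measure_isProbability.Build _ _ _ (mass_one_probability mu1) mu1.

End mass_one.

Definition kernel_probability d (E : measurableType d) (R : realType)
    (k : R.-pker E ~> R) (x : E) : probability R R :=
  mass_one_probability (prob_kernel (s := k) x).

Section kernel_pullback.
Context d (E : measurableType d) (R : realType) (k : E -> probability R R)
  (mk : forall U, measurable U -> measurable_fun setT (fun x => k x U)).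

Section pullback.
Context d' (X : measurableType d').

(** The measurability proof is an argument so that the kernel structure can be
    inferred from the term. *)
Definition kernel_pullback (phi : X -> E) of measurable_fun setT phi :
  X -> {measure set R -> \bar R} := fun x => k (phi x).

Variables (phi : X -> E) (mphi : measurable_fun setT phi).

Let measurable_kernel U : measurable U ->
  measurable_fun setT (fun x => kernel_pullback mphi x U).
Proof.
by move=> mU; exact: (measurableT_comp (mk mU) mphi).
Qed.

HB.instance Definition _ := isKernel.Build _ _ _ _ _ (kernel_pullback mphi)
  measurable_kernel.

Let prob_kernel x : kernel_pullback mphi x setT = 1%E.
Proof. by rewrite /kernel_pullback; exact: probability_setT. Qed.

HB.instance Definition _ := Kernel_isProbability.Build _ _ _ _ _
  (kernel_pullback mphi) prob_kernel.

Lemma measurable_integral_pullback (f : X * R -> \bar R) :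
  (forall z, 0 <= f z)%E -> measurable_fun setT f ->
  measurable_fun setT (fun x => \int[k (phi x)]_y f (x, y))%E.
Proof.
move=> f0 mf.
exact: (measurable_fun_integral_finite_kernel f (kernel_pullback mphi)).
Qed.

Lemma measurable_xsection_pullback (A : set (X * R)) : measurable A ->
  measurable_fun setT (fun x => fine (k (phi x) (xsection A x))).
Proof.
move=> mA; apply: measurableT_comp => //.
apply: (measurable_fun_xsection_finite_kernel (kernel_pullback mphi)).
by rewrite inE.
Qed.

End pullback.

(** [mid_cdf] is half the sum of the masses of sections of two half-planes, hence
    jointly measurable in the law and the level; a second integration, against
    [k x.2], gives the relative effect. *)
Lemma measurable_relative_effect :
  measurable_fun setT (fun x : E * E => relative_effect (k x.1) (k x.2)).
Proof.
pose X := (E * E * R)%type.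
have m11 : measurable_fun setT (fun p : X => p.1.1) by exact: measurableT_comp.
have mlt : measurable [set p : X * R | p.2 < p.1.2].
  rewrite -[X in measurable X]setTI; apply: measurable_fun_ltr => //.
  exact: measurableT_comp.
have mle : measurable [set p : X * R | p.2 <= p.1.2].
  rewrite -[X in measurable X]setTI; apply: measurable_fun_ler => //.
  exact: measurableT_comp.
have mmid : measurable_fun setT (fun p : X => mid_cdf (k p.1.1) p.2).
  have -> : (fun p : X => mid_cdf (k p.1.1) p.2) = (fun p => 2^-1 *
      (fine (k p.1.1 (xsection [set p : X * R | p.2 < p.1.2] p)) +
       fine (k p.1.1 (xsection [set p : X * R | p.2 <= p.1.2] p)))).
    apply/funext => p; rewrite mid_cdfE; congr (_ * (fine (k _ _) + fine (k _ _)));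
    by apply/seteqP; split => x; rewrite /xsection /= in_itv/= ?inE.
  apply: measurable_funM => //; apply: measurable_funD;
    exact: measurable_xsection_pullback.
apply: measurableT_comp => //.
apply: (@measurable_integral_pullback _ _ snd measurable_snd
  (fun p => (mid_cdf (k p.1.1) p.2)%:E)).
- by move=> p; rewrite lee_fin mid_cdf_ge0.
- exact/measurable_EFinP.
Qed.

End kernel_pullback.

(** * Separation coefficient one and complete separation *)

Lemma Rintegral_eq0_ae d (T : measurableType d) (R : realType)
    (P : probability T R) (f : T -> R) (M : R) :
  measurable_fun setT f -> (forall x, 0 <= f x <= M) ->
  \int[P]_x f x = 0 <-> {ae P, forall x, f x = 0}.
Proof.
move=> mf f0M.
have fint : P.-integrable setT (EFin \o f).
  apply: (@probability_bounded_integrable _ _ _ _ _ M) => // x.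
  by have /andP[f0 fM] := f0M x; rewrite ger0_norm.
have intf : (\int[P]_x `|(f x)%:E| = (\int[P]_x f x)%:E)%E.
  rewrite /Rintegral fineK; last exact: integrable_fin_num.
  apply: eq_integral => x _.
  by have /andP[f0 fM] := f0M x; rewrite gee0_abs// lee_fin.
have /ae_eq_integral_abs : measurable_fun setT (EFin \o f) by exact/measurable_EFinP.
move=> /(_ P measurableT); rewrite /= intf => fae.
split=> [i0|f0].
  have : ae_eq P setT (EFin \o f) (cst 0%E) by apply/fae; rewrite i0.
  by apply: filterS => x /(_ I)/= [].
apply/EFin_inj/fae.
by apply: filterS f0 => x /= ->.
Qed.

Section separation_coefficient.
Context d (E : measurableType d) (R : realType) (rho : probability E R)
  (k : E -> probability R R)
  (mk : forall U, measurable U -> measurable_fun setT (fun x => k x U))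
  (mdiag : measurable [set x : E * E | x.1 = x.2])
  (rho_nondirac : forall x, rho [set x] != 1%E).

Local Notation rho2 := (rho \x rho)%E.
Local Notation diag := [set x : E * E | x.1 = x.2].
Local Notation eff := (fun x : E * E => relative_effect (k x.1) (k x.2)).

Let mset1 (x : E) : measurable [set x].
Proof.
rewrite (_ : [set x] = xsection diag x); first exact: measurable_xsection.
by apply/seteqP; split => y; rewrite /xsection/= inE/=.
Qed.

(** The mass of the diagonal is the mean of [rho {x}]; were it [1], almost every
    [x] would carry the full mass of [rho]. *)
Lemma product_diag_lt1 : fine (rho2 diag) < 1.
Proof.
rewrite lt_neqAle fine_probability_le1// andbT; apply/negP => /eqP diag1.
have mf : measurable_fun setT (fun x => fine (rho [set x])).
  apply: measurableT_comp => //.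
  rewrite (_ : (fun x => _) = rho \o xsection diag); first exact: measurable_fun_xsection.
  apply/funext => x /=; congr (rho _).
  by apply/seteqP; split => y; rewrite /xsection/= inE/=.
have : {ae rho, forall x, 1 - fine (rho [set x]) = 0}.
  apply/(@Rintegral_eq0_ae _ _ _ _ _ 1); first exact: measurable_funB.
    by move=> x; rewrite subr_ge0 fine_probability_le1//= gerBl fine_ge0.
  rewrite RintegralB//.
  - rewrite Rintegral_cst// fine_probabilityT mulr1 -diag1; apply/eqP.
    rewrite subr_eq0; apply/eqP; congr fine; apply: eq_integral => x _.
    rewrite EFin_fine_probability//; congr (rho _).
    by apply/seteqP; split => y; rewrite /xsection/= inE/=.
  - exact: finite_measure_integrable_cst.
  - apply: (@probability_bounded_integrable _ _ _ _ _ 1) => // x.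
    by rewrite ger0_norm ?fine_ge0 ?fine_probability_le1.
move=> [N [mN N0 sN]].
have : rho setT = 0%E.
  apply: subset_measure0 N0 => //.
  move=> x _; apply: sN => /eqP; rewrite subr_eq0 eq_sym => /eqP h.
  by have := rho_nondirac x; rewrite -EFin_fine_probability// h eqxx.
by rewrite [rho _](@probability_setT _ _ _ rho) => /eqP; rewrite onee_eq0.
Qed.

(** The defect of the coefficient is the integral of [eff (1 - eff)] over the
    complement of the diagonal, a nonnegative function. *)
Lemma separation_coef_eq1 :
  4 / (1 - fine (rho2 diag)) * \int[rho2]_x (eff x - 2^-1) ^+ 2 = 1 <->
  {ae rho2, forall x, x.1 <> x.2 -> eff x = 0 \/ eff x = 1}.
Proof.
have meff := measurable_relative_effect mk.
have effb x : 0 <= eff x <= 1.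
  by rewrite relative_effect_ge0 relative_effect_le1.
(* the defect [1/4 - (eff - 1/2)^2], cut off on the diagonal *)
pose g x : R := \1_(~` diag) x * (eff x * (1 - eff x)).
have mg : measurable_fun setT g.
  apply: measurable_funM; first exact/measurable_indic/measurableC.
  by apply: measurable_funM => //; exact: measurable_funB.
have gb x : 0 <= g x <= 1.
  rewrite /g indicE; case: (_ \in _); rewrite ?mul1r ?mul0r ?lexx ?ler01//.
  by have := effb x; nra.
have gE x : (eff x - 2^-1) ^+ 2 = 4^-1 * \1_(~` diag) x - g x.
  rewrite /g indicE; have [_|] := boolP (x \in ~` diag).
    by rewrite mulr1 mul1r; field.
  rewrite notin_setE /= => /contrapT ->.
  by rewrite relative_effect_diag subrr expr0n/= !mulr0 mul0r subr0.
have gint : rho2.-integrable setT (EFin \o g).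
  apply: (@probability_bounded_integrable _ _ _ _ _ 1) => // x.
  by have /andP[g0 g1] := gb x; rewrite ger0_norm.
have iint : rho2.-integrable setT (EFin \o (fun x => 4^-1 * \1_(~` diag) x : R)).
  apply: (@probability_bounded_integrable _ _ _ _ _ 1) => [|x].
    by apply: measurable_funM => //; exact/measurable_indic/measurableC.
  by rewrite indicE; case: (_ \in _); rewrite ?mulr1 ?mulr0 ?normr0// ger0_norm//; lra.
have -> : \int[rho2]_x (eff x - 2^-1) ^+ 2 =
    4^-1 * (1 - fine (rho2 diag)) - \int[rho2]_x g x.
  under eq_Rintegral do rewrite gE.
  rewrite RintegralB// RintegralZl//; last first.
    apply: (@probability_bounded_integrable _ _ _ _ _ 1) => [|x].
      exact/measurable_indic/measurableC.
    by rewrite indicE; case: (_ \in _); rewrite ?normr0// normr1.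
  rewrite {1}/Rintegral integral_indic//; last exact: measurableC.
  by rewrite setIT fine_probabilityC.
have dlt := product_diag_lt1.
transitivity (\int[rho2]_x g x = 0).
  set q := \int[rho2]_x g x.
  have -> : 4 / (1 - fine (rho2 diag)) *
      (4^-1 * (1 - fine (rho2 diag)) - q) = 1 - 4 / (1 - fine (rho2 diag)) * q.
    by field; rewrite subr_eq0 gt_eqF.
  split=> [/eqP|->]; last by rewrite mulr0 subr0.
  rewrite subr_eq addrC -subr_eq subrr eq_sym mulf_eq0 => /orP[|/eqP//].
  by rewrite gt_eqF// divr_gt0// subr_gt0.
rewrite (Rintegral_eq0_ae _ mg gb); split; apply: filterS => x.
  rewrite /g indicE => + /= xd; rewrite mem_set//= mul1r => /eqP.
  rewrite mulf_eq0 subr_eq0 => /orP[/eqP ->|/eqP <-]; by [left|right].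
rewrite /g indicE; have [/set_mem xd|_ _] := boolP (x \in _); last by rewrite mul0r.
by move=> /(_ xd)[->|->]; rewrite ?mul0r ?subrr ?mulr0.
Qed.

End separation_coefficient.

(** * Null sets of a product and the precedence of laws *)

Lemma ae_xsection d1 d2 (T1 : measurableType d1) (T2 : measurableType d2)
    (R : realType) (P1 : probability T1 R) (P2 : probability T2 R)
    (Q : T1 * T2 -> Prop) :
  {ae (P1 \x P2)%E, forall x, Q x} ->
  {ae P1, forall x, {ae P2, forall y, Q (x, y)}}.
Proof.
move=> [N [mN N0 sN]].
have mf : measurable_fun setT (fun x => fine (P2 (xsection N x))).
  by apply: measurableT_comp => //; exact: measurable_fun_xsection.
have : {ae P1, forall x, fine (P2 (xsection N x)) = 0}.
  apply/(@Rintegral_eq0_ae _ _ _ _ _ 1) => //.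
    move=> x; rewrite fine_ge0//= fine_probability_le1//.
    exact: measurable_xsection.
  have -> : 0 = fine ((P1 \x P2)%E N) by rewrite N0.
  congr fine; apply: eq_integral => x _ /=.
  by rewrite EFin_fine_probability//; exact: measurable_xsection.
apply: filterS => x Nx0.
exists (xsection N x); split; first exact: measurable_xsection.
  by rewrite -EFin_fine_probability ?Nx0//; exact: measurable_xsection.
by move=> y Qxy; rewrite /xsection/= inE; apply: sN.
Qed.

Lemma ae_atom d (T : measurableType d) (R : realType)
    (P : probability T R) (Q : T -> Prop) (z : T) :
  measurable [set z] -> (0 < P [set z])%E ->
  {ae P, forall x, Q x} -> Q z.
Proof.
move=> mz Pz [N [mN N0 sN]]; apply: contrapT => Qz.
have : P [set z] = 0%E by apply: subset_measure0 N0 => // x ->; exact: sN.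
by move=> Pz0; rewrite Pz0 ltxx in Pz.
Qed.

Lemma ae_probability_ex d (T : measurableType d) (R : realType)
    (P : probability T R) (W : set T) (Q : T -> Prop) :
  measurable W -> P W != 0%E -> {ae P, forall x, Q x} -> exists2 x, W x & Q x.
Proof.
move=> mW W0 [N [mN N0 sN]]; apply: contrapT => nex.
move/eqP: W0; apply; apply: subset_measure0 N0 => // x Wx.
by apply: sN => Qx; apply: nex; exists x.
Qed.

Lemma mem_set1E (T : eqType) (x z : T) : (x \in [set z]%classic) = (x == z).
Proof. by apply/idP/eqP; rewrite inE. Qed.

Section precedes.
Context {R : realType}.
Implicit Types (mu nu : probability R R) (D : set R).

Lemma fine_probability_gt0 d (T : measurableType d) (P : probability T R) A :
  measurable A -> (fine (P A) != 0) = (0 < P A)%E.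
Proof.
by move=> mA; rewrite -[P A]EFin_fine_probability// lte_fin lt0r fine_ge0// andbT.
Qed.

Lemma down_set_ex mu D : down_set D -> fine (mu D) != 0 ->
  exists2 y, D y & fine (mu `]-oo, y]%classic) != 0.
Proof.
move=> dD; apply: contraNP => nex; apply/eqP.
suff : (mu D <= 0)%E by rewrite measure_le0 => /eqP ->.
apply: measure_down_set_le => // y Dy; rewrite leNgt; apply/negP => y0.
by apply: nex; exists y => //; rewrite fine_probability_gt0.
Qed.

Lemma down_setC_ex mu D : down_set D -> fine (mu (~` D)) != 0 ->
  exists2 y, ~ D y & fine (mu `[y, +oo[%classic) != 0.
Proof.
move=> dD; apply: contraNP => nex; apply/eqP.
suff : (mu (~` D) <= 0)%E by rewrite measure_le0 => /eqP ->.
apply: measure_setC_down_set_le => // y Dy; rewrite leNgt; apply/negP => y0.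
by apply: nex; exists y => //; rewrite fine_probability_gt0.
Qed.

(** If [nu] reaches [y] in [D] from below and [mu] reaches [y'] outside [D] from
    above, then [y < y'] and precedence fails at [y]. *)
Lemma precedes_down_set mu nu D : precedes mu nu -> down_set D ->
  fine (mu D) = 1 \/ fine (nu D) = 0.
Proof.
move=> munu dD; have mD := down_set_measurable dD.
have [|] := eqVneq (fine (nu D)) 0; first by right.
move=> /(down_set_ex dD)[y Dy nuy]; left.
apply/eqP; rewrite eq_sym -subr_eq0 -fine_probabilityC//.
apply: contraT => /(down_setC_ex dD)[y' Dy' muy'].
have [muy|nuy0] := munu y; last by rewrite nuy0 eqxx in nuy.
case/negP: muy'; rewrite eq_le fine_ge0// andbT -muy le_fine_probability//.
apply: subset_itvr; rewrite bnd_simp leNgt; apply/negP => y'y.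
by apply: Dy'; exact: dD (ltW y'y).
Qed.

(** The levels not yet reached by [nu] form the separating down-set. *)
Lemma precedes_separating mu nu : precedes mu nu ->
  exists D, [/\ down_set D, fine (mu D) = 1 & fine (nu D) = 0].
Proof.
move=> munu; exists [set y | fine (nu `]-oo, y]%classic) = 0].
set D := [set y | _].
have dD : down_set D.
  move=> x y /= Dy xy; apply/eqP; rewrite eq_le fine_ge0// andbT -Dy.
  by apply: le_fine_probability => //; apply: subset_itvl.
have mD := down_set_measurable dD.
split => //; last first.
  apply/eqP; apply: contraT => /(down_set_ex dD)[y Dy].
  by rewrite Dy eqxx.
apply/eqP; rewrite eq_sym -subr_eq0 -fine_probabilityC//.
apply: contraT => /(down_setC_ex dD)[y Dy /eqP].
by have [->|] := munu y.
Qed.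

End precedes.

(** * From complete separation to an ordinal sum *)

Section cdf_level.
Context {R : realType} (m : probability R R).

Lemma fine_cdf_le (x y : R) : x <= y ->
  fine (m `]-oo, x]%classic) <= fine (m `]-oo, y]%classic).
Proof.
by move=> xy; apply: le_fine_probability => //; apply: subset_itvl;
  rewrite bnd_simp.
Qed.

Lemma measurable_fine_cdf :
  measurable_fun setT (fun y : R => fine (m `]-oo, y]%classic)).
Proof. by apply: nondecreasing_measurable => // x y; exact: fine_cdf_le. Qed.

Definition cdf_level (u : R) := [set y | fine (m `]-oo, y]%classic) <= u].

Lemma down_set_cdf_level (u : R) : down_set (cdf_level u).
Proof.
by move=> x y Fy xy; apply: le_trans Fy; exact: fine_cdf_le.
Qed.

Lemma measurable_cdf_level (u : R) : measurable (cdf_level u).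
Proof. by apply: down_set_measurable; exact: down_set_cdf_level. Qed.

Lemma sub_cdf_level (u v : R) : u <= v -> cdf_level u `<=` cdf_level v.
Proof. by move=> uv y Fy; exact: le_trans uv. Qed.

Lemma cdf_level1 : cdf_level 1 = setT.
Proof. by apply/seteqP; split => // y _; exact: fine_probability_le1. Qed.

Lemma lebesgue_measure_itv0 (u : R) : 0 <= u ->
  lebesgue_measure `[0%R, u]%classic = u%:E.
Proof.
move=> u0; rewrite lebesgue_measure_itv/= lte_fin.
by case: ltP => [|u0']; [rewrite oppr0 addr0|congr EFin; lra].
Qed.

End cdf_level.

(** In this section [m], the law of [Y], is the mixture of the laws [k x], and
    [lev u] is the event [F_Y(Y) <= u] seen on the side of [Y]. *)
Section separated_mixture.
Context d (E : measurableType d) (R : realType) (rho : probability E R)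
  (k : E -> probability R R) (m : probability R R)
  (mk : forall U, measurable U -> measurable_fun setT (fun x => k x U))
  (mset1 : forall x : E, measurable [set x])
  (mE : forall B, measurable B -> (m B = \int[rho]_x k x B)%E).

Local Notation eff := (fun x : E * E => relative_effect (k x.1) (k x.2)).

Hypothesis sep : {ae (rho \x rho)%E, forall x, x.1 <> x.2 -> eff x = 0 \/ eff x = 1}.

Definition atoms := [set z | (0 < rho [set z])%E].

Local Notation F y := (fine (m `]-oo, y]%classic)).
Local Notation lev := (cdf_level m).

Definition comparable_from x := {ae rho, forall y, x <> y ->
  eff (x, y) = 0 \/ eff (x, y) = 1}.

Lemma ae_comparable_from : {ae rho, forall x, comparable_from x}.
Proof. exact: ae_xsection sep. Qed.

Lemma atom_comparable z : atoms z -> comparable_from z.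
Proof. by move=> Mz; exact: ae_atom Mz ae_comparable_from. Qed.

Lemma atoms_comparable z z' : atoms z -> atoms z' -> z <> z' ->
  eff (z, z') = 0 \/ eff (z, z') = 1.
Proof.
by move=> Mz Mz'; apply: (ae_atom (mset1 z') Mz' (atom_comparable Mz)).
Qed.

Lemma countable_atoms_rho : countable atoms.
Proof. exact: countable_atoms. Qed.

Lemma measurable_atoms : measurable atoms.
Proof.
by apply: countable_measurable => //; exact: countable_atoms_rho.
Qed.

(** Otherwise some [x] of [W], not an atom, is comparable with almost every point;
    since no other point of [W] is comparable with [x], the set [W] is [{x}] up
    to a null set, so it is null. *)
Lemma unseparated_null (W : set E) : measurable W ->
  (forall x y, W x -> W y -> x <> y -> ~ (eff (x, y) = 0 \/ eff (x, y) = 1)) ->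
  rho (W `\` atoms) = 0%E.
Proof.
move=> mW nW; apply: contrapT => /eqP W0; apply: (elimN eqP W0).
have mWM : measurable (W `\` atoms) by apply: measurableD => //; exact: measurable_atoms.
have [x [Wx Mx]] := ae_probability_ex mWM W0 ae_comparable_from.
move=> [N [mN N0 sN]].
have x0 : rho [set x] = 0%E.
  by apply/eqP; rewrite eq_le measure_ge0 andbT leNgt; exact/negP.
apply/eqP; rewrite -measure_le0.
rewrite (@le_trans _ _ (rho (N `|` [set x])))//.
  apply: le_measure; rewrite ?inE//; first exact: measurableU.
  move=> y [Wy _]; have [->|/eqP xy] := eqVneq y x; first by right.
  left; apply: sN; move=> /(_ (nesym xy)).
  by apply: nW => //; exact: nesym.
by rewrite le_eqVlt (etrans (measureU0 mN (mset1 x) x0) N0) eqxx.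
Qed.

Lemma measurable_kernel_fine B : measurable B ->
  measurable_fun setT (fun x => fine (k x B)).
Proof. by move=> mB; apply: measurableT_comp => //; exact: mk. Qed.

Lemma integrable_kernel_fine B : measurable B ->
  rho.-integrable setT (EFin \o (fun x => fine (k x B))).
Proof.
move=> mB; apply: (@probability_bounded_integrable _ _ _ _ _ 1).
  exact: measurable_kernel_fine.
by move=> x; rewrite ger0_norm ?fine_ge0 ?fine_probability_le1.
Qed.

Lemma fine_mixture B : measurable B -> fine (m B) = \int[rho]_x fine (k x B).
Proof.
move=> mB; rewrite mE//; congr fine; apply: eq_integral => x _.
by rewrite EFin_fine_probability.
Qed.

(** Two laws charging the same point are not separated, so only atoms of [rho] can
    contribute to an atom of the mixture. *)
Lemma mixture_point_atom q : fine (m [set q]) != 0 ->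
  exists2 z, atoms z & fine (k z [set q]) != 0.
Proof.
apply: contraNP => nex; apply/eqP.
have mkq := measurable_kernel_fine (measurable_set1 q).
pose W := [set x | fine (k x [set q]) != 0].
have mW : measurable W.
  rewrite (_ : W = (fun x => fine (k x [set q])) @^-1` (~` [set 0])).
    by rewrite -[X in measurable X]setTI; apply: mkq => //; exact: measurableC.
  by apply/seteqP; split => x /= /eqP.
have W0 : rho W = 0%E.
  have -> : W = W `\` atoms.
    by apply/seteqP; split => x []//; split => // Mx; apply: nex; exists x.
  have gt (P : probability R R) (A : set R) : [set q] `<=` A -> measurable A ->
      fine (P [set q]) != 0 -> fine (P A) <> 0.
    move=> qA mA Pq PA; case/negP: Pq; rewrite eq_le fine_ge0// andbT -PA.
    exact: le_fine_probability.
  have gt1 (P : probability R R) : fine (P [set q]) != 0 ->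
      fine (P `[q, +oo[%classic) <> 0.
    by apply: gt => // x -> /=; rewrite in_itv/= lexx.
  have gt2 (P : probability R R) : fine (P [set q]) != 0 ->
      fine (P `]-oo, q]%classic) <> 0.
    by apply: gt => // x -> /=; rewrite in_itv/= lexx.
  apply: unseparated_null => // x y Wx Wy xy [e0|e1].
    have [] := relative_effect0_precedes e0 q; [exact: gt1|exact: gt2].
  have [] := relative_effect1_precedes e1 q; [exact: gt1|exact: gt2].
rewrite fine_mixture//.
apply/(@Rintegral_eq0_ae _ _ _ rho _ 1) => //.
  by move=> x; rewrite fine_ge0//= fine_probability_le1.
by exists W; split => // x /= /eqP.
Qed.

(** Two laws both split by [D] are not separated. *)
Lemma nonatom_down_set D : down_set D ->
  {ae rho, forall x, ~ atoms x -> fine (k x D) = 0 \/ fine (k x D) = 1}.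
Proof.
move=> dD; have mD := down_set_measurable dD.
have mkD := measurable_kernel_fine mD.
pose W := [set x | fine (k x D) <> 0 /\ fine (k x D) <> 1].
have mW : measurable W.
  rewrite (_ : W = (fun x => fine (k x D)) @^-1` (~` [set 0] `&` ~` [set 1])).
    rewrite -[X in measurable X]setTI; apply: mkD => //.
    by apply: measurableI; exact: measurableC.
  by apply/seteqP; split => x.
exists (W `\` atoms); split.
- by apply: measurableD => //; exact: measurable_atoms.
- apply: unseparated_null => // x y [/= Wx0 Wx1] [/= Wy0 Wy1] xy [e0|e1].
    by have [] := precedes_down_set (relative_effect0_precedes e0) dD.
  by have [] := precedes_down_set (relative_effect1_precedes e1) dD.
- move=> x /not_implyP[Mx /not_orP[h0 h1]].
  by split.
Qed.

(** The relative effect is taken from [z], the first argument, because sections of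
    null sets are taken at the first coordinate; [eff (z, x) = 0] makes [k x]
    precede [k z]. *)
Definition below z := [set x | z <> x /\ eff (z, x) = 0].

Lemma measurable_below z : measurable (below z).
Proof.
have meff : measurable_fun setT (fun x => eff (z, x)).
  exact: (measurableT_comp (measurable_relative_effect mk) (measurable_pair1 z)).
rewrite (_ : below z = ~` [set z] `&` ((fun x => eff (z, x)) @^-1` [set 0])).
  apply: measurableI; first exact: measurableC.
  by rewrite -[X in measurable X]setTI; apply: meff.
by apply/seteqP; split => x [/= zx e]; split => //; exact: nesym.
Qed.

(** The block of [z] is the range [F_Y] takes on the support of [k z]: [F_Y] first
    collects all the laws preceding [k z], then the mass of [z] itself. *)
Definition block_low z := fine (rho (below z)).
Definition block_mass z := fine (rho [set z]).
Definition block_high z := block_low z + block_mass z.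

Lemma Rintegral_below (c : R) z (N : set E) : measurable N ->
  \int[rho]_x (\1_N x + c * \1_[set z] x) = fine (rho N) + c * block_mass z.
Proof.
move=> mN.
have i1 (A : set E) : measurable A -> rho.-integrable setT (EFin \o (\1_A : E -> R)).
  by move=> mA; exact: integrable_indic.
rewrite RintegralD//; last 2 first.
- exact: i1.
- apply: (@probability_bounded_integrable _ _ _ _ _ `|c|).
    by apply: measurable_funM => //; exact: measurable_indic.
  by move=> x; rewrite normrM indicE; case: (_ \in _);
    rewrite ?normr1 ?normr0 ?mulr1 ?mulr0.
rewrite RintegralZl//; last exact: i1.
by rewrite /Rintegral !integral_indic// !setIT.
Qed.

Lemma integrable_below (c : R) z (N : set E) : measurable N ->
  rho.-integrable setT (EFin \o (fun x => \1_N x + c * \1_[set z] x)).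
Proof.
move=> mN; apply: (@probability_bounded_integrable _ _ _ _ _ (1 + `|c|)).
  apply: measurable_funD; first exact: measurable_indic.
  by apply: measurable_funM => //; exact: measurable_indic.
move=> x; rewrite (le_trans (ler_normD _ _))// lerD//.
  by rewrite indicE; case: (_ \in _); rewrite ?normr1 ?normr0.
by rewrite normrM indicE; case: (_ \in _); rewrite ?normr1 ?normr0 ?mulr1 ?mulr0.
Qed.

(** The points below [z] contribute their full mass, [z] the part of its law in
    [B]. *)
Lemma mixture_ge_below B z : measurable B -> atoms z ->
  (forall x, precedes (k x) (k z) -> fine (k x B) = 1) ->
  block_low z + fine (k z B) * block_mass z <= fine (m B).
Proof.
move=> mB Mz below1.
rewrite -Rintegral_below; last exact: measurable_below.
rewrite fine_mixture//; apply: le_Rintegral => //.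
- by apply: integrable_below; exact: measurable_below.
- exact: integrable_kernel_fine.
move=> x _; rewrite !indicE mem_set1E; have [->|/eqP xz] := eqVneq x z.
  by rewrite memNset ?add0r ?mulr1// => -[].
rewrite mulr0 addr0; have [/set_mem[_ e0]|_] := boolP (x \in _).
  by rewrite below1//; exact: relative_effect0_precedes e0.
exact: fine_ge0.
Qed.

(** Almost every [x] is below [z], equal to [z], or preceded by [k z], and the
    last ones contribute nothing. *)
Lemma mixture_le_below B z : measurable B -> atoms z ->
  (forall x, precedes (k z) (k x) -> fine (k x B) = 0) ->
  fine (m B) <= block_low z + fine (k z B) * block_mass z.
Proof.
move=> mB Mz above0.
have [N [mN N0 sN]] := atom_comparable Mz.
have mbN : measurable (below z `|` N).
  by apply: measurableU => //; exact: measurable_below.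
have -> : block_low z = fine (rho (below z `|` N)).
  by rewrite /block_low measureU0//; exact: measurable_below.
rewrite -Rintegral_below//.
rewrite fine_mixture//; apply: le_Rintegral => //.
- exact: integrable_kernel_fine.
- exact: integrable_below.
move=> x _; rewrite !indicE mem_set1E; have [->|/eqP xz] := eqVneq x z.
  by rewrite mulr1 lerDr; case: (_ \in _).
rewrite mulr0 addr0; have [_|] := boolP (x \in _).
  exact: fine_probability_le1.
rewrite notin_setE => /not_orP[nb nN].
rewrite above0//; have [e0|e1] : eff (z, x) = 0 \/ eff (z, x) = 1.
- by apply: contrapT => h; apply: nN; apply: sN => /(_ (nesym xz)).
- by exfalso; apply: nb; split => //; exact: nesym.
- exact: relative_effect1_precedes e1.
Qed.

Lemma block_low_ge0 z : 0 <= block_low z.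
Proof. exact: fine_ge0. Qed.

Lemma block_mass_gt0 z : atoms z -> 0 < block_mass z.
Proof. by move=> Mz; rewrite lt0r fine_probability_gt0// Mz fine_ge0. Qed.

Lemma block_high_le1 z : block_high z <= 1.
Proof.
have mb := measurable_below z.
rewrite /block_high -fine_probabilityU ?fine_probability_le1//.
  exact: measurableU.
by apply/seteqP; split => // x [[zx _] /= xz]; apply: zx.
Qed.

(** If [k x] precedes [k y], the mass of a down-set separating them lies between
    the top of the block of [x] and the bottom of the block of [y]. *)
Lemma blocks_ordered z z' : atoms z -> atoms z' -> z <> z' ->
  block_high z <= block_low z' \/ block_high z' <= block_low z.
Proof.
have h x y : atoms x -> atoms y -> precedes (k x) (k y) ->
    block_high x <= block_low y.
  move=> Mx My /[dup] xy /precedes_separating[D [dD xD yD]].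
  have mD := down_set_measurable dD.
  have := @mixture_ge_below _ _ mD Mx; rewrite xD mul1r => lo.
  have := @mixture_le_below _ _ mD My; rewrite yD mul0r addr0 => hi.
  apply: (le_trans (lo _) (hi _)) => w /precedes_down_set /(_ dD)[]//.
    by rewrite xD => /eqP; rewrite oner_eq0.
  by rewrite yD => /eqP; rewrite eq_sym oner_eq0.
move=> Mz Mz' zz'; have [e0|e1] := atoms_comparable Mz Mz' zz'.
  by right; apply: h => //; exact: relative_effect0_precedes e0.
by left; apply: h => //; exact: relative_effect1_precedes e1.
Qed.

Lemma cdf_gt_block_low z y : atoms z -> fine (k z `]-oo, y]%classic) != 0 ->
  block_low z < F y.
Proof.
move=> Mz kzy; apply: lt_le_trans (mixture_ge_below _ Mz _) => //.
  by rewrite ltrDl mulr_gt0 ?block_mass_gt0// lt0r kzy fine_ge0.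
move=> x /(_ y)[xy|/eqP]; last by rewrite (negPf kzy).
have := fine_probabilityC (k x) (measurable_itv `]-oo, y]).
rewrite setCitvl => /eqP; rewrite eq_sym subr_eq addrC -subr_eq => /eqP <-.
suff -> : fine (k x `]y, +oo[%classic) = 0 by rewrite subr0.
apply/eqP; rewrite eq_le fine_ge0// andbT -xy le_fine_probability//.
by apply: subset_itvr; rewrite bnd_simp.
Qed.

Lemma cdf_le_block_high z y : atoms z -> fine (k z `[y, +oo[%classic) != 0 ->
  F y <= block_high z.
Proof.
move=> Mz kzy; apply: le_trans (mixture_le_below _ Mz _) _ => //.
  by move=> x /(_ y)[/eqP|//]; rewrite (negPf kzy).
rewrite lerD2l ger_pMl ?block_mass_gt0//; exact: fine_probability_le1.
Qed.

(** [k z]-almost every [y] is reached by [k z] from below, and there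
    [F_Y(y) > block_low z]. *)
Lemma kernel_lev_low z : atoms z -> fine (k z (lev (block_low z))) = 0.
Proof.
move=> Mz; apply/eqP; apply: contraT => /(down_set_ex (@down_set_cdf_level _ m _))[y /= Fy].
by move=> /(cdf_gt_block_low Mz); rewrite ltNge Fy.
Qed.

Lemma kernel_lev_high z : atoms z -> fine (k z (lev (block_high z))) = 1.
Proof.
move=> Mz; apply/eqP; rewrite eq_sym -subr_eq0 -fine_probabilityC; last first.
  exact: measurable_cdf_level.
apply: contraT => /(down_setC_ex (@down_set_cdf_level _ m _))[y /= Fy].
by move=> /(cdf_le_block_high Mz).
Qed.

Definition cut (u : R) := forall z, atoms z -> ~ (block_low z < u < block_high z).

(** Only a jump of [F_Y] across [u], at some atom [y] of [Y], can make the mass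
    smaller than [u]. Such a [y] is charged by [k z] for an atom [z], and then
    [block_low z <= F_Y(y-) < u < F_Y(y) <= block_high z]. *)
Lemma mixture_lev (u : R) : 0 <= u <= 1 -> cut u -> fine (m (lev u)) = u.
Proof.
move=> /andP[u0 u1] cutu; have mlev := measurable_cdf_level m u.
apply/eqP; rewrite eq_le; apply/andP; split.
  rewrite -lee_fin EFin_fine_probability//.
  apply: measure_down_set_le => //; first exact: down_set_cdf_level.
  by move=> y /= Fy; rewrite -EFin_fine_probability// lee_fin.
rewrite leNgt; apply/negP => ltu.
(* otherwise the upper half-lines outside the level would bound its complement *)
have [y Fy yu] : exists2 y, ~ lev u y & 1 - u < fine (m `[y, +oo[%classic).
  apply: contrapT => nex.
  suff : fine (m (~` lev u)) <= 1 - u by rewrite fine_probabilityC// lerD2l lerN2 leNgt ltu.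
  rewrite -lee_fin EFin_fine_probability; last exact: measurableC.
  apply: measure_setC_down_set_le; [exact: down_set_cdf_level|by rewrite lee_fin subr_ge0|].
  move=> y Fy; apply: (le_trans (y := (fine (m `[y, +oo[%classic))%:E)).
    by rewrite EFin_fine_probability.
  rewrite lee_fin leNgt; apply/negP => yu.
  by apply: nex; exists y.
have {}yu : fine (m `]-oo, y[%classic) < u.
  by move: yu; rewrite -setCitvl fine_probabilityC// ltrD2l ltrN2.
move: Fy => /= /negP; rewrite -ltNge => Fy.
have Fydecomp : F y = fine (m `]-oo, y[%classic) + fine (m [set y]).
  rewrite -(@setUitv1 _ _ -oo%O y true)// fine_probabilityU//.
  by apply/seteqP; split => // x [/=]; rewrite in_itv/= => /[swap] ->; rewrite ltxx.
have [z Mz kzy] : exists2 z, atoms z & fine (k z [set y]) != 0.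
  by apply: mixture_point_atom; rewrite gt_eqF//; lra.
have kzge : fine (k z `[y, +oo[%classic) != 0.
  move: kzy; apply: contraNN => /eqP h; rewrite eq_le fine_ge0// andbT -h.
  by apply: le_fine_probability => // x -> /=; rewrite in_itv/= lexx.
have kzle : fine (k z `]-oo, y]%classic) != 0.
  move: kzy; apply: contraNN => /eqP h; rewrite eq_le fine_ge0// andbT -h.
  by apply: le_fine_probability => // x -> /=; rewrite in_itv/= lexx.
apply: (cutu _ Mz); apply/andP; split; last first.
  exact: lt_le_trans Fy (cdf_le_block_high Mz kzge).
apply: le_lt_trans yu.
apply: le_trans (mixture_ge_below (measurable_itv `]-oo, y[) Mz _).
  by rewrite lerDl mulr_ge0 ?fine_ge0// ltW// block_mass_gt0.
move=> x /(_ y)[xy|/eqP]; last by rewrite (negPf kzle).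
apply/eqP; rewrite eq_sym -subr_eq0 -fine_probabilityC//.
by rewrite setCitvl xy.
Qed.

Local Notation block z := `]block_low z, block_high z]%classic.

Lemma trivIset_block : trivIset atoms (fun z => block z).
Proof.
move=> z z' Mz Mz' [x [/=]]; rewrite !in_itv/= => /andP[zx xz] /andP[z'x xz'].
apply: contrapT => zz'.
have [h|h] := blocks_ordered Mz Mz' zz'; lra.
Qed.

Lemma block_low_lt_high z : atoms z -> block_low z < block_high z.
Proof. by move=> Mz; rewrite ltrDl block_mass_gt0. Qed.

Lemma cut_block_low z : atoms z -> cut (block_low z).
Proof.
move=> Mz z' Mz' /andP[lo hi].
have zz' : z <> z' by move=> zz'; rewrite zz' ltxx in lo.
have := block_low_lt_high Mz; have := block_low_lt_high Mz'.
have [h|h] := blocks_ordered Mz Mz' zz'; lra.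
Qed.

Lemma cut_block_high z : atoms z -> cut (block_high z).
Proof.
move=> Mz z' Mz' /andP[lo hi].
have zz' : z <> z' by move=> zz'; rewrite zz' ltxx in hi.
have := block_low_lt_high Mz; have := block_low_lt_high Mz'.
have [h|h] := blocks_ordered Mz Mz' zz'; lra.
Qed.

Lemma kernel_lev_cut z (u : R) : atoms z -> 0 <= u <= 1 -> cut u ->
  (rho [set z] * k z (lev u) =
   lebesgue_measure (`[0%R, u]%classic `&` block z))%E.
Proof.
move=> Mz /andP[u0 u1] cutu.
have [uz|zu] := leP u (block_low z).
  have -> : k z (lev u) = 0%E.
    rewrite -EFin_fine_probability; last exact: measurable_cdf_level.
    congr EFin; apply/eqP; rewrite eq_le fine_ge0// andbT.
    rewrite -(kernel_lev_low Mz) le_fine_probability//;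
      [exact: measurable_cdf_level|exact: measurable_cdf_level|exact: sub_cdf_level].
  rewrite mule0 (_ : _ `&` _ = set0) ?measure0//.
  by apply/seteqP; split => // x [/=]; rewrite !in_itv/= => /andP[_ h1] /andP[h2 _]; lra.
have {}zu : block_high z <= u.
  by rewrite leNgt; apply/negP => uz; apply: (cutu _ Mz); rewrite zu.
have -> : k z (lev u) = 1%E.
  rewrite -EFin_fine_probability; last exact: measurable_cdf_level.
  congr EFin; apply/eqP; rewrite eq_le fine_probability_le1//=; last exact: measurable_cdf_level.
  rewrite -(kernel_lev_high Mz) le_fine_probability//;
      [exact: measurable_cdf_level|exact: measurable_cdf_level|exact: sub_cdf_level].
rewrite mule1 (_ : _ `&` _ = block z); last first.
  apply/seteqP; split => [x []//|x /=]; rewrite !in_itv/= => /andP[h1 h2].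
  by have := block_low_ge0 z; split; [apply/andP; split; lra|rewrite h1 h2].
rewrite lebesgue_measure_itv/= lte_fin block_low_lt_high// -EFinB.
by rewrite /block_high addrAC subrr add0r EFin_fine_probability.
Qed.

Let gaps (u : R) := `[0%R, u]%classic `\` \bigcup_(z in atoms) block z.

Let measurable_blocks : measurable (\bigcup_(z in atoms) block z).
Proof.
by apply: measurable_countable_bigcup => //; exact: countable_atoms_rho. Qed.

Lemma measurable_gaps u : measurable (gaps u).
Proof. by apply: measurableD. Qed.

(** At a cut the level and [[0, u]] have the same measure, and the contributions
    of the atoms to the first are those of the blocks to the second. *)
Lemma nonatom_lev_cut (u : R) : 0 <= u <= 1 -> cut u ->
  (\int[rho]_(x in ~` atoms) k x (lev u) = lebesgue_measure (gaps u))%E.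
Proof.
move=> /[dup] u01 /andP[u0 u1] cutu.
have mM := measurable_atoms.
have mkl : measurable_fun setT (fun x => k x (lev u)) by apply: mk; exact: measurable_cdf_level.
have := mE (measurable_cdf_level m u).
rewrite -EFin_fine_probability; last exact: measurable_cdf_level.
rewrite mixture_lev// -(setUv atoms).
rewrite (ge0_integral_setU _ mM (measurableC mM))//; last 2 first.
- exact: measurable_funTS.
- by apply/disj_setPS => x [].
rewrite integral_atoms//; last exact: countable_atoms_rho.
rewrite (eq_esum (fun z Mz => kernel_lev_cut Mz u01 cutu)).
set S := \esum_(z in _) _ => h.
have S0 : (0 <= S)%E by apply: esum_ge0.
have Sfin : S \is a fin_num.
  rewrite ge0_fin_numE//; apply: (@le_lt_trans _ _ u%:E); last exact: ltry.
  by rewrite h leeDl// integral_ge0.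
suff : (S + \int[rho]_(x in ~` atoms) k x (lev u) = S + lebesgue_measure (gaps u))%E.
  by move=> /(congr1 (fun x => x - S)%E); rewrite ![(S + _)%E]addeC !addeK.
rewrite -h -(lebesgue_measure_itv0 u0) (measureDI lebesgue_measure (measurable_itv `[0, u]) measurable_blocks).
rewrite addeC; congr (_ + _)%E.
rewrite setI_bigcupr; apply: measure_countable_bigcup.
- exact: countable_atoms_rho.
- by move=> z Mz; exact: measurableI.
- by apply: trivIset_setIl; exact: trivIset_block.
Qed.

(** Inside a block both sides are monotone between their values at the ends of the
    block, which are cuts, and the Lebesgue side does not move there. *)
Lemma nonatom_lev (u : R) : 0 <= u <= 1 ->
  (\int[rho]_(x in ~` atoms) k x (lev u) = lebesgue_measure (gaps u))%E.
Proof.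
move=> u01.
have [cutu|ncut] := pselect (cut u); first exact: nonatom_lev_cut.
have [z [Mz /andP[lu uh]]] : exists z, atoms z /\ block_low z < u < block_high z.
  by apply: contrapT => nex; apply: ncut => z Mz zu; apply: nex; exists z.
have lo0 := block_low_ge0 z; have hi1 := block_high_le1 z.
have mono v w : v <= w -> (\int[rho]_(x in ~` atoms) k x (lev v) <=
    \int[rho]_(x in ~` atoms) k x (lev w))%E.
  move=> vw; apply: ge0_le_integral => //.
  - by apply: measurableC; exact: measurable_atoms.
  - by apply: measurable_funTS; apply: mk; exact: measurable_cdf_level.
  - by apply: measurable_funTS; apply: mk; exact: measurable_cdf_level.
  - move=> x _; apply: le_measure;
      [by apply: mem_set; exact: measurable_cdf_level|by apply: mem_set; exact: measurable_cdf_level|exact: sub_cdf_level].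
have sub_gaps v w : v <= w -> gaps v `<=` gaps w.
  move=> vw x [/= + nb]; rewrite in_itv/= => /andP[x0 xv].
  by split => //=; rewrite in_itv/= x0 (le_trans xv).
have gap_high : gaps (block_high z) `<=` gaps (block_low z).
  move=> x [/= + nb]; rewrite in_itv/= => /andP[x0 xv].
  split => //=; rewrite in_itv/= x0/= leNgt; apply/negP => lx.
  by apply: nb; exists z => //=; rewrite in_itv/= lx xv.
apply/eqP; rewrite eq_le; apply/andP; split.
  apply: le_trans (mono _ _ (ltW uh)) _.
  rewrite nonatom_lev_cut; last exact: cut_block_high; last by lra.
  apply: le_measure;
    [by apply: mem_set; exact: measurable_gaps|by apply: mem_set; exact: measurable_gaps|].
  by apply: subset_trans gap_high _; apply: sub_gaps; exact: ltW.
apply: le_trans (mono _ _ (ltW lu)).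
rewrite nonatom_lev_cut; last exact: cut_block_low; last by lra.
apply: le_measure;
    [by apply: mem_set; exact: measurable_gaps|by apply: mem_set; exact: measurable_gaps|].
by apply: subset_trans gap_high; apply: sub_gaps; exact: ltW.
Qed.

(** The conditional probabilities are [0] or [1] and increase with the level. *)
Lemma nonatom_lev_prod (u v : R) :
  (\int[rho]_(x in ~` atoms) (k x (lev u) * k x (lev v)) =
   \int[rho]_(x in ~` atoms) k x (lev (Num.min u v)))%E.
Proof.
wlog uv : u v / u <= v.
  move=> h; have /orP[/h//|vu] := le_total u v.
  by rewrite minC -h//; apply: eq_integral => x _; exact: muleC.
rewrite (min_idPl uv).
apply: ae_eq_integral => //.
- by apply: measurableC; exact: measurable_atoms.
- by apply: measurable_funTS; apply: emeasurable_funM; apply: mk; exact: measurable_cdf_level.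
- by apply: measurable_funTS; apply: mk; exact: measurable_cdf_level.
apply: filterS (nonatom_down_set (@down_set_cdf_level _ m u)) => x kx Mx.
have mlu := measurable_cdf_level m u; have mlv := measurable_cdf_level m v.
rewrite -(EFin_fine_probability (k x) mlu) -(EFin_fine_probability (k x) mlv).
have [->|k1] := kx Mx; first by rewrite mul0e.
have -> : fine (k x (lev v)) = 1.
  apply/eqP; rewrite eq_le fine_probability_le1//= -k1.
  by apply: le_fine_probability => //; exact: sub_cdf_level.
by rewrite mule1.
Qed.

Definition block_cdf z u v := fine (k z (lev u)) * fine (k z (lev v)).

Lemma separated_ordinal_sum (u v : R) : 0 <= u <= 1 -> 0 <= v <= 1 ->
  (\int[rho]_x (k x (lev u) * k x (lev v)))%E =
  ordinal_sum atoms block_low block_high block_cdf u v.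
Proof.
move=> u01 v01.
have mkk : measurable_fun setT (fun x => k x (lev u) * k x (lev v))%E.
  by apply: emeasurable_funM; apply: mk; exact: measurable_cdf_level.
have mM := measurable_atoms.
rewrite -(setUv atoms).
rewrite (ge0_integral_setU _ mM (measurableC mM))//; last 3 first.
- exact: measurable_funTS.
- by move=> x _; rewrite mule_ge0.
- by apply/disj_setPS => x [].
congr (_ + _)%E.
  rewrite (integral_atoms _ mset1 countable_atoms_rho)//; last first.
    by move=> x; rewrite mule_ge0.
  apply: eq_esum => z Mz.
  rewrite /block_high addrAC subrr add0r /block_cdf !EFinM.
  by rewrite !EFin_fine_probability//; exact: measurable_cdf_level.
by rewrite nonatom_lev_prod nonatom_lev//; case: (leP u v).
Qed.

Lemma block_cdf_supported z : atoms z ->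
  cdf2_supported (block_low z) (block_high z) (block_cdf z).
Proof.
move=> Mz.
pose Fm : {mfun R >-> R} := HB.pack (fun y => F y)
  (isMeasurableFun.Build _ _ _ _ _ (measurable_fine_cdf m)).
pose mu : probability (R * R)%type R := (distribution (k z) Fm \x distribution (k z) Fm)%E.
exists mu; split.
  move=> u v; apply: esym; apply: etrans (product_measure1E _ _ _ _) _ => //.
  rewrite /block_cdf EFinM.
  by rewrite !EFin_fine_probability//; exact: measurable_cdf_level.
apply: etrans (product_measure1E _ _ _ _) _ => //.
suff : distribution (k z) Fm `]block_low z, block_high z]%classic = 1%E.
  by move=> h; rewrite [X in (X * _)%E]h [X in (_ * X)%E]h mule1.
have h0 := kernel_lev_low Mz; have h1 := kernel_lev_high Mz.
have ml := measurable_cdf_level m (block_low z).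
have mh := measurable_cdf_level m (block_high z).
transitivity (k z (lev (block_high z) `\` lev (block_low z))).
  congr (k z _); apply/seteqP; split => y /=; rewrite in_itv/=.
    by move=> /andP[lo hi]; split => //; apply/negP; rewrite -ltNge.
  by move=> [-> /negP]; rewrite -ltNge => ->.
rewrite -EFin_fine_probability; last exact: measurableD.
congr EFin; apply: (addrI (fine (k z (lev (block_low z))))).
rewrite -fine_probabilityU//; last 2 first.
- exact: measurableD.
- by rewrite setDIK.
rewrite setDUK ?h1 ?h0 ?add0r//; apply: sub_cdf_level.
by rewrite ltW// block_low_lt_high.
Qed.

End separated_mixture.

(** * From an ordinal sum to complete separation *)

Section supported_cdf.
Context {R : realType} (a b : R) (F : R -> R -> R).
Hypothesis supF : cdf2_supported a b F.

Lemma cdf2_supported_eq1 u v : b <= u -> b <= v -> F u v = 1.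
Proof.
move=> bu bv; have [mu [Fmu mu1]] := supF.
apply/EFin_inj; rewrite Fmu; apply/eqP; rewrite eq_le; apply/andP; split.
  by apply: probability_le1; exact: measurableX.
rewrite -mu1; apply: le_measure; rewrite ?inE; [exact: measurableX..|].
by move=> [x y] [/=]; rewrite !in_itv/= => /andP[_ xb] /andP[_ yb]; split;
  [exact: le_trans bu|exact: le_trans bv].
Qed.

Lemma cdf2_supported_eq0 u v : u <= a -> F u v = 0.
Proof.
move=> ua; have [mu [Fmu mu1]] := supF.
have mr : measurable (`]-oo, u]%classic `*` `]-oo, v]%classic) by exact: measurableX.
have mb : measurable (`]a, b]%classic `*` `]a, b]%classic) by exact: measurableX.
apply/EFin_inj; rewrite Fmu.
have : (mu (`]-oo, u] `*` `]-oo, v]) <= mu (~` (`]a, b] `*` `]a, b])))%E.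
  apply: le_measure; rewrite ?inE//; first exact: measurableC.
  move=> [x y] [/=]; rewrite in_itv/= => xu _ [/=]; rewrite in_itv/= => /andP[ax _] _.
  by have := lt_le_trans ax (le_trans xu ua); rewrite ltxx.
rewrite (probability_setC _ mb) [X in (1 - X)%E]mu1 subee// measure_le0.
by move/eqP.
Qed.

End supported_cdf.

Section ordinal_sum_separated.
Context d (E : measurableType d) (R : realType) (rho : probability E R)
  (k : E -> probability R R) (m : probability R R)
  (mk : forall U, measurable U -> measurable_fun setT (fun x => k x U))
  (mset1 : forall x : E, measurable [set x])
  (mE : forall B, measurable B -> (m B = \int[rho]_x k x B)%E).

Local Notation eff := (fun x : E * E => relative_effect (k x.1) (k x.2)).
Local Notation atoms := (atoms rho).

Local Notation lev := (cdf_level m).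

Variables (a b : E -> R) (G : E -> R -> R -> R).

Local Notation block z := `]a z, b z]%classic.

Hypotheses (ord_data : ordinal_sum_data atoms a b G)
  (blockE : forall z, atoms z -> (b z - a z)%:E = rho [set z])
  (ordE : forall u v : R, 0 <= u <= 1 -> 0 <= v <= 1 ->
    (\int[rho]_x (k x (lev u) * k x (lev v)))%E = ordinal_sum atoms a b G u v).

Let countable_rho : countable atoms.
Proof. exact: countable_atoms. Qed.

Definition block_cut (u : R) := 0 <= u <= 1 /\
  forall z, atoms z -> ~ (a z < u < b z).

(** At a cut each block lies entirely below or above [u], so that its term is the
    length of its part in [[0, u]] and the formula measures [[0, u]]. *)
Lemma ordinal_sum_cut u w : block_cut u -> u <= w -> 
  ordinal_sum atoms a b G u w = u%:E.
Proof.
move=> [/andP[u0 u1] cutu] uw; have [_ bnd tI supp] := ord_data.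
have mU : measurable (\bigcup_(z in atoms) block z).
  by apply: measurable_countable_bigcup => //; exact: countable_rho.
rewrite -[RHS](lebesgue_measure_itv0 u0) (measureDI lebesgue_measure (measurable_itv `[0, u]) mU).
rewrite addeC /ordinal_sum (min_idPl uw); congr (_ + _)%E.
rewrite setI_bigcupr; apply: esym; apply: etrans (measure_countable_bigcup _ _ _ _) _.
- exact: countable_rho.
- by move=> z Mz; exact: measurableI.
- by apply: trivIset_setIl; exact: tI.
apply: eq_esum => z Mz; have [a0 [ab b1]] := bnd z Mz.
have [uz|zu] := leP u (a z).
  rewrite (cdf2_supported_eq0 (supp z Mz))// mulr0 (_ : _ `&` _ = set0) ?measure0//.
  by apply/seteqP; split => // x [/=]; rewrite !in_itv/= => /andP[_ h1] /andP[h2 _]; lra.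
have {}zu : b z <= u.
  by rewrite leNgt; apply/negP => uz; apply: (cutu _ Mz); rewrite zu.
rewrite (cdf2_supported_eq1 (supp z Mz))//; last exact: le_trans uw.
rewrite mulr1 (_ : _ `&` _ = block z); last first.
  apply/seteqP; split => [x []//|x /=]; rewrite !in_itv/= => /andP[h1 h2].
  by split; [apply/andP; split; lra|rewrite h1 h2].
apply: etrans (lebesgue_measure_itv `]a z, b z]) _.
by rewrite /= lte_fin ab -EFinB.
Qed.

Let mlev u : measurable (lev u).
Proof. exact: measurable_cdf_level. Qed.

Let f u x := fine (k x (lev u)).

Let mf u : measurable_fun setT (f u).
Proof. by apply: measurableT_comp => //; apply: mk; exact: measurable_cdf_level. Qed.

Let f01 u x : 0 <= f u x <= 1.
Proof. by rewrite /f fine_ge0//= fine_probability_le1. Qed.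

Let fint u : rho.-integrable setT (EFin \o f u).
Proof.
apply: (@probability_bounded_integrable _ _ _ _ _ 1) => // x.
by have /andP[f0 f1] := f01 u x; rewrite ger0_norm.
Qed.

Let integral_level u w : block_cut u -> u <= w <= 1 ->
  \int[rho]_x (f u x * f w x) = u.
Proof.
move=> cu /andP[uw w1]; have [/andP[u0 u1] _] := cu.
have := ordinal_sum_cut cu uw; rewrite -ordE; last 2 first.
- by rewrite u0.
- by rewrite w1 andbT; lra.
move=> /(congr1 fine) h; apply: etrans h; congr fine; apply: eq_integral => x _.
by rewrite EFinM !EFin_fine_probability.
Qed.

Let f1 x : f 1 x = 1.
Proof. by rewrite /f cdf_level1 fine_probabilityT. Qed.

Let integral_level1 u : block_cut u -> \int[rho]_x f u x = u.
Proof.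
move=> cu; have [/andP[u0 u1] _] := cu.
rewrite -[RHS](integral_level cu (w := 1)) ?u1 ?lexx//.
by apply: eq_Rintegral => x _; rewrite f1 mulr1.
Qed.

(** By [integral_level] and [integral_level1], [f u] and its square have the same
    integral. *)
Let level_cut_ae u : block_cut u -> {ae rho, forall x, f u x = 0 \/ f u x = 1}.
Proof.
move=> cu; have [/andP[u0 u1] _] := cu.
have : {ae rho, forall x, f u x - f u x * f u x = 0}.
  have ff : rho.-integrable setT (EFin \o (fun x => f u x * f u x)).
    apply: (@probability_bounded_integrable _ _ _ _ _ 1) => [|x].
      exact: measurable_funM.
    by have /andP[f0 f1'] := f01 u x; rewrite ger0_norm; nra.
  apply/(@Rintegral_eq0_ae _ _ _ _ _ 1).
  - by apply: measurable_funB => //; exact: measurable_funM.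
  - by move=> x; have := f01 u x; nra.
  - by rewrite RintegralB// integral_level1// integral_level ?lexx ?subrr.
apply: filterS => x /eqP; rewrite -{1}[f u x]mulr1 -mulrBr mulf_eq0 subr_eq0.
by move=> /orP[/eqP ->|/eqP <-]; [left|right].
Qed.

(** The points whose conditional law lives in the level [u]. *)
Let S u := [set x | f u x = 1].

Let mS u : measurable (S u).
Proof.
rewrite -[X in measurable X]setTI (_ : S u = f u @^-1` [set 1])//.
exact: mf.
Qed.

Let SS u v : u <= v -> S u `<=` S v.
Proof.
move=> uv x /= Su; have /andP[_ f1'] := f01 v x.
apply/eqP; rewrite eq_le f1'/= -Su; apply: le_fine_probability => //.
exact: sub_cdf_level.
Qed.

Let rhoS u : block_cut u -> fine (rho (S u)) = u.
Proof.
move=> cu; rewrite -[RHS]integral_level1//.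
have -> : fine (rho (S u)) = \int[rho]_x \1_(S u) x.
  by rewrite /Rintegral integral_indic// setIT.
congr fine; apply: ae_eq_integral => //.
- exact/measurable_EFinP/measurable_indic.
- exact/measurable_EFinP.
apply: filterS (level_cut_ae cu) => x + _; rewrite indicE.
have [/set_mem ->//|] := boolP (x \in S u).
by rewrite notin_setE /S/= => n1 [->|].
Qed.

Let rhoSD u v : block_cut u -> block_cut v -> u <= v ->
  fine (rho (S v `\` S u)) = v - u.
Proof.
move=> cu cv uv; apply: (addrI (fine (rho (S u)))).
rewrite -fine_probabilityU//; last 2 first.
- exact: measurableD.
- by rewrite setDIK.
rewrite setDUK; last exact: SS.
by rewrite !rhoS//; lra.
Qed.

Let cut_a z : atoms z -> block_cut (a z).
Proof.
move=> Mz; have [_ bnd tI _] := ord_data; have [a0 [ab b1]] := bnd z Mz.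
split; first by apply/andP; split; lra.
move=> z' Mz' /andP[lo hi].
have zz' : z = z'.
  apply: tI => //; exists (Num.min (b z) (b z')).
  by split; rewrite /= in_itv/= lt_min ge_min ?lexx ?orbT andbT; apply/andP; split; lra.
by rewrite zz' ltxx in lo.
Qed.

Let cut_b z : atoms z -> block_cut (b z).
Proof.
move=> Mz; have [_ bnd tI _] := ord_data; have [a0 [ab b1]] := bnd z Mz.
split; first by apply/andP; split; lra.
move=> z' Mz' /andP[lo hi].
have zz' : z = z'.
  apply: tI => //; exists (b z).
  by split; rewrite /= in_itv/=; apply/andP; split => //; exact: ltW.
by rewrite zz' ltxx in hi.
Qed.

Let cut0 : block_cut 0.
Proof.
split; first by rewrite lexx ler01.
by move=> z Mz; have [_ bnd _ _] := ord_data; have [a0 _] := bnd z Mz; lra.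
Qed.

Let cut1 : block_cut 1.
Proof.
split; first by rewrite lexx ler01.
by move=> z Mz; have [_ bnd _ _] := ord_data; have [_ [_ b1]] := bnd z Mz; lra.
Qed.

(** The points whose law puts [F_Y(Y)] in the block of [z]; that this set is [{z}]
    up to a null set is known only at the end. *)
Let A z := S (b z) `\` S (a z).

Let mA z : measurable (A z). Proof. exact: measurableD. Qed.

Let rhoA z : atoms z -> rho (A z) = rho [set z].
Proof.
move=> Mz; have [_ bnd _ _] := ord_data; have [a0 [ab b1]] := bnd z Mz.
rewrite -blockE// -[LHS]EFin_fine_probability// rhoSD//.
- exact: cut_a.
- exact: cut_b.
- exact: ltW.
Qed.

Let blocks_le z z' : atoms z -> atoms z' -> z <> z' -> b z <= a z' \/ b z' <= a z.
Proof.
move=> Mz Mz' zz'; have [_ bnd tI _] := ord_data.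
have [a0 [ab b1]] := bnd z Mz; have [a0' [ab' b1']] := bnd z' Mz'.
have [|h1] := leP (b z) (a z'); first by left.
have [|h2] := leP (b z') (a z); first by right.
exfalso; apply: zz'; apply: tI => //; exists (Num.min (b z) (b z')).
by split; rewrite /= in_itv/= lt_min ge_min ?lexx ?orbT ?andbT; apply/andP.
Qed.

Let tA : trivIset atoms A.
Proof.
move=> z z' Mz Mz' [x [[Sb nSa] [Sb' nSa']]].
apply: contrapT => zz'; have [h|h] := blocks_le Mz Mz' zz'.
  by apply: nSa'; exact: SS Sb.
by apply: nSa; exact: SS Sb'.
Qed.

(** Almost-everywhere statements allow countably many cuts. Rational ones alone
    may be too few: when a rational falls inside a block, an end of that block
    replaces it. *)
Let C := [set u | block_cut u /\
  ((exists2 z, atoms z & u = a z) \/ (exists2 z, atoms z & u = b z) \/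
   exists q : rat, u = ratr q)].

Let countable_C : countable C.
Proof.
apply: (@sub_countable _ _ _ ((a @` atoms) `|` ((b @` atoms) `|` (range (ratr : rat -> R))))).
  apply: subset_card_le => u [_ [[z Mz ->]|[[z Mz ->]|[q ->]]]].
  - by left; exists z.
  - by right; left; exists z.
  - by right; right; exists q.
apply: countable_setU; first exact: sub_countable (card_image_le _ _) countable_rho.
apply: countable_setU; first exact: sub_countable (card_image_le _ _) countable_rho.
exact: sub_countable (card_image_le _ _) (countableP _).
Qed.

Let unsep := [set p : E * E | forall u, C u -> S u p.1 <-> S u p.2].

Let munsep : measurable unsep.
Proof.
rewrite (_ : unsep = ~` \bigcup_(u in C)
    ((S u `*` ~` S u) `|` (~` S u `*` S u))).
  apply: measurableC; apply: measurable_countable_bigcup; first exact: countable_C.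
  by move=> u _; apply: measurableU; apply: measurableX => //; exact: measurableC.
apply/seteqP; split => [p us [u Cu [[/=]|[/=]]]|p np u Cu].
- by move=> S1 nS2; apply: nS2; apply/(us u Cu).
- by move=> nS1 S2; apply: nS1; apply/(us u Cu).
- split => Su; apply: contrapT => nS; apply: np; exists u => //.
    by left.
  by right.
Qed.

Let N := [set p : E * E | [/\ ~ S 0 p.1, ~ (\bigcup_(z in atoms) A z) p.1 &
  unsep p]].

Let mbigA : measurable (\bigcup_(z in atoms) A z).
Proof. by apply: measurable_countable_bigcup; first exact: countable_rho. Qed.

Let mN : measurable N.
Proof.
rewrite (_ : N = (~` S 0 `*` setT) `&`
  ((~` (\bigcup_(z in atoms) A z) `*` setT) `&` unsep)).
  apply: measurableI; first by apply: measurableX => //; exact: measurableC.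
  apply: measurableI => //; apply: measurableX => //; exact: measurableC.
by apply/seteqP; split => [p [? ? ?]|p [[? _] [[? _] ?]]].
Qed.

(** The section at [x] is contained in [S u] minus [S u'], of mass [u - u'], as soon
    as the cuts [u'] and [u] enclose [x]. They can be chosen arbitrarily close
    because [x] lies in none of the sets [A z]. *)
Let xsectionN x : fine (rho (xsection N x)) = 0.
Proof.
have mx : measurable (xsection N x) by exact: measurable_xsection.
have [[nS0 nA]|nx] := pselect (~ S 0 x /\ ~ (\bigcup_(z in atoms) A z) x); last first.
  rewrite (_ : xsection N x = set0) ?measure0//.
  by apply/seteqP; split => // y; rewrite /xsection/= inE => -[? ? _]; apply: nx.
apply/eqP; rewrite eq_le fine_ge0// andbT; apply/ler_addgt0Pr => e e0; rewrite add0r.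
suff [u' [u [Cu' Cu nS Su ue]]] : exists u' u, [/\ C u', C u, ~ S u' x, S u x & u - u' <= e].
  have u'u : u' <= u.
    by rewrite leNgt; apply/negP => /ltW /SS uu'; apply: nS; exact: uu'.
  apply: le_trans ue; rewrite -rhoSD//; [|by case: Cu'|by case: Cu].
  apply: le_fine_probability => //; first exact: measurableD.
  move=> y; rewrite /xsection/= inE => -[_ _ us]; split.
    by apply/(us u Cu).
  by move=> /(us u' Cu').
(* the cuts that lie below [x]; [u'] is chosen near their supremum *)
pose Lo := [set u | C u /\ ~ S u x].
have Lo0 : Lo 0.
  by split => //; split; [exact: cut0|right; right; exists 0; rewrite rmorph0].
have hsLo : has_sup Lo.
  split; first by exists 0.
  by exists 1 => u [[[/andP[_ u1] _] _] _].
have [u' [Cu' nS] u't] := sup_adherent (divr_gt0 e0 (ltr0n _ 2)) hsLo.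
set t := sup Lo in u't.
have Lot u : Lo u -> u <= t by move=> Lu; exact: sup_upper_bound.
exists u'; have [t1|t1] := ltP 1 (t + e / 2).
  have C1 : C 1 by split; [exact: cut1|right; right; exists 1; rewrite rmorph1].
  have S1 : S 1 x := f1 x.
  by exists 1; split => //; lra.
have tlt : t < t + e / 2 by rewrite ltrDl divr_gt0.
have [q] := rat_in_itvoo tlt; rewrite inE/= => /andP[]; rewrite !bnd_simp => tq qt.
have t0 := Lot _ Lo0.
have q01 : 0 <= (ratr q : R) <= 1 by apply/andP; split; lra.
(* a rational just above the supremum, or the lower end of its block *)
have [cq|ncq] := pselect (block_cut (ratr q)).
  have Cq : C (ratr q) by split => //; right; right; exists q.
  exists (ratr q); split => //; last by lra.
  by apply: contrapT => nSq; have := Lot (ratr q) (conj Cq nSq); rewrite leNgt tq.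
have [z [Mz /andP[aq qb]]] : exists z, atoms z /\ a z < ratr q < b z.
  by apply: contrapT => nex; apply: ncq; split => // z Mz zu; apply: nex; exists z.
have Cb : C (b z) by split; [exact: cut_b|right; left; exists z].
have Ca : C (a z) by split; [exact: cut_a|left; exists z].
have Sb : S (b z) x.
  by apply: contrapT => nSq; have := Lot _ (conj Cb nSq); lra.
exists (a z); split => //; last by lra.
by apply: contrapT => nSa; apply: nA; exists z.
Qed.

(** Pairs that no cut separates lie, up to null sets, in the union [B] of the
    squares of the sets [A z]. This union contains the union [D] of the squares
    of the atoms and has the same measure. *)
Lemma ordinal_sum_separates : {ae (rho \x rho)%E, forall x, x.1 <> x.2 ->
  eff x = 0 \/ eff x = 1}.
Proof.
pose rho2 : probability (E * E)%type R := (rho \x rho)%E.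
have rhoN : rho2 N = 0%E.
  rewrite /rho2/= /product_measure1; apply: integral0_eq => x _ /=.
  rewrite -EFin_fine_probability ?xsectionN//; exact: measurable_xsection.
have S00 : rho (S 0) = 0%E.
  by rewrite -EFin_fine_probability// rhoS//; exact: cut0.
pose B := \bigcup_(z in atoms) (A z `*` A z).
pose D := \bigcup_(z in atoms) ([set z] `*` [set z]).
have mB : measurable B.
  apply: measurable_countable_bigcup; first exact: countable_rho.
  by move=> z _; exact: measurableX.
have mD : measurable D.
  apply: measurable_countable_bigcup; first exact: countable_rho.
  by move=> z _; exact: measurableX.
(* an atom outside every [A z] would belong to its own null section of [N] *)
have DB : D `<=` B.
  move=> [_ _] [z Mz [/= -> ->]].
  have nS0 : ~ S 0 z.
    move=> S0z; have : rho [set z] = 0%E by apply: subset_measure0 S00 => // x ->.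
    by move=> rz; move: Mz; rewrite /atoms/= rz ltxx.
  have [[z' Mz' Az']|nA] := pselect ((\bigcup_(z in atoms) A z) z); first by exists z'.
  have : fine (rho [set z]) <= 0.
    rewrite -(xsectionN z); apply: le_fine_probability => //.
      exact: measurable_xsection.
    by move=> x ->; rewrite /xsection/= inE; split.
  by rewrite leNgt -lte_fin EFin_fine_probability// Mz.
have rhoBD : rho2 B = rho2 D.
  rewrite (measure_countable_bigcup rho2); last 3 first.
  - exact: countable_rho.
  - by move=> z _; exact: measurableX.
  - by move=> z z' Mz Mz' [[x y] [[/= Ax _] [Ax' _]]]; apply: tA => //; exists x.
  rewrite (measure_countable_bigcup rho2); last 3 first.
  - exact: countable_rho.
  - by move=> z _; exact: measurableX.
  - by move=> z z' _ _ [[x y] [[/= -> _] [-> _]]].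
  apply: eq_esum => z Mz; apply: etrans (product_measure1E _ _ _ _) _ => //.
  apply: esym; apply: etrans (product_measure1E _ _ _ _) _ => //.
  by congr (_ * _)%E; apply: esym; exact: rhoA.
have rhoB0 : rho2 (B `\` D) = 0%E.
  rewrite -EFin_fine_probability; last exact: measurableD.
  congr EFin; apply: (addrI (fine (rho2 D))); rewrite -fine_probabilityU//; last 2 first.
  - exact: measurableD.
  - by rewrite setDIK.
  by rewrite setDUK// rhoBD addr0.
have [N1 [mN1 N10 sN1]] : {ae rho, forall x, forall u, C u -> f u x = 0 \/ f u x = 1}.
  apply: ae_countable; first exact: countable_C.
  by move=> u [cu _]; exact: level_cut_ae.
exists (N `|` (((S 0 `|` N1) `*` setT) `|` ((setT `*` N1) `|` (B `\` D)))).
split.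
- apply: measurableU => //; apply: measurableU.
    by apply: measurableX => //; exact: measurableU.
  by apply: measurableU; [exact: measurableX|exact: measurableD].
- have h1 : rho2 ((S 0 `|` N1) `*` setT) = 0%E.
    apply: etrans (product_measure1E _ _ _ _) _ => //; first exact: measurableU.
    by rewrite [X in (X * _)%E](etrans (measureU0 (mS 0) mN1 N10) S00) mul0e.
  have h2 : rho2 (setT `*` N1) = 0%E.
    apply: etrans (product_measure1E _ _ _ _) _ => //.
    by rewrite [X in (_ * X)%E]N10 mule0.
  have mx : measurable ((S 0 `|` N1) `*` [set: E]).
    by apply: measurableX => //; exact: measurableU.
  have my : measurable ([set: E] `*` N1) by exact: measurableX.
  have mBD : measurable (B `\` D) by exact: measurableD.
  have h3 : rho2 ((setT `*` N1) `|` (B `\` D)) = 0%E.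
    exact: etrans (measureU0 my mBD rhoB0) h2.
  have h4 : rho2 (((S 0 `|` N1) `*` setT) `|` ((setT `*` N1) `|` (B `\` D))) = 0%E.
    exact: etrans (measureU0 mx (measurableU _ _ my mBD) h3) h1.
  apply: etrans (measureU0 mN _ h4) rhoN.
  by apply: measurableU => //; exact: measurableU.
- move=> [x y] /= /not_implyP[xy neff]; apply: contrapT.
  move=> /not_orP[nN /not_orP[nx /not_orP[ny nB]]]; apply: neff.
  have Nx1 : ~ N1 x by move=> ?; apply: nx; split => //; right.
  have Ny1 : ~ N1 y by move=> ?; apply: ny; split.
  have Nx0 : ~ S 0 x by move=> ?; apply: nx; split => //; left.
  have fx : forall u, C u -> f u x = 0 \/ f u x = 1 by apply: contrapT => /sN1.
  have fy : forall u, C u -> f u y = 0 \/ f u y = 1 by apply: contrapT => /sN1.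
  have nus : ~ unsep (x, y).
    move=> us; have [[z Mz [Sb nSa]]|nA] := pselect ((\bigcup_(z in atoms) A z) x); last by apply: nN.
    apply: nB; split.
      exists z => //; split => //; split => /=.
        by apply/(us (b z)); [split; [exact: cut_b|right; left; exists z]|].
      by move=> /(us (a z)) h; apply: nSa; apply: h; split; [exact: cut_a|left; exists z].
    by move=> [z' Mz' [/= xz yz]]; apply: xy; rewrite xz yz.
  have [u [Cu h]] : exists u, C u /\ ~ (S u x <-> S u y).
    by apply: contrapT => nex; apply: nus => u Cu; apply: contrapT => h; apply: nex; exists u.
  have [fx0|fx1] := fx u Cu; have [fy0|fy1] := fy u Cu.
  + exfalso; apply: h; rewrite /S/= fx0 fy0; tauto.
  + left; have [] := relative_effect_separated (@down_set_cdf_level _ m u) fy1 fx0; tauto.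
  + right; have [] := relative_effect_separated (@down_set_cdf_level _ m u) fx1 fy0; tauto.
  + exfalso; apply: h; rewrite /S/= fx1 fy1; tauto.
Qed.

End ordinal_sum_separated.

(** * Random vectors and their conditional laws *)

Section tuple_measurability.
Context {R : realType} {p : nat}.

Lemma measurable_tuple_diagonal :
  measurable [set x : p.-tuple R * p.-tuple R | x.1 = x.2].
Proof.
have -> : [set x : p.-tuple R * p.-tuple R | x.1 = x.2] =
    \bigcap_(i in [set: 'I_p])
      ((fun x => tnth x.1 i - tnth x.2 i) @^-1` [set 0]).
  apply/seteqP; split => [x /= x12 i _ /=|x xi]; first by rewrite x12 subrr.
  apply/eq_from_tnth => i; apply/eqP; rewrite -subr_eq0.
  by have /= -> := xi i I.
apply: fin_bigcap_measurable => // i _.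
rewrite -[X in measurable X]setTI.
have mi : measurable_fun [set: p.-tuple R * p.-tuple R]
    (fun x => tnth x.1 i - tnth x.2 i).
  apply: measurable_funB.
    exact: (measurableT_comp (measurable_tnth i) measurable_fst).
  exact: (measurableT_comp (measurable_tnth i) measurable_snd).
exact: mi.
Qed.

Lemma measurable_tuple_set1 (z : p.-tuple R) : measurable [set z].
Proof.
rewrite (_ : [set z] = xsection [set x | x.1 = x.2] z).
  by apply: measurable_xsection; exact: measurable_tuple_diagonal.
by apply/seteqP; split => y; rewrite /xsection/= inE/=.
Qed.

End tuple_measurability.

Section conditional_law.
Context d dX (T : measurableType d) (TX : measurableType dX) (R : realType)
  (P : probability T R) (X : {RV P >-> TX}).

Lemma cond_distribution_ae (Y : {RV P >-> R}) (k1 k2 : R.-pker TX ~> R)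
    (B : set R) : cond_distribution X Y k1 -> cond_distribution X Y k2 ->
  measurable B -> {ae distribution P X, forall x, k1 x B = k2 x B}.
Proof.
move=> c1 c2 mB.
have : ae_eq (distribution P X) setT (fun x => k1 x B) (fun x => k2 x B).
  apply: integral_ae_eq => //.
  - apply/integrableP; split; first exact: measurable_kernel.
    apply: (@le_lt_trans _ _ (\int[distribution P X]_x 1)%E).
      apply: ge0_le_integral => //.
      - by apply: measurableT_comp => //; exact: measurable_kernel.
      - move=> x _; rewrite gee0_abs//.
        by rewrite -(prob_kernel (s := k1) x); apply: le_measure; rewrite ?inE.
    by rewrite integral_cst// mul1e (le_lt_trans (probability_le1 _ _))// ltry.
  - exact: measurable_kernel.
  - by move=> A _ mA; rewrite -c1// -c2.
by apply: filterS => x; apply.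
Qed.

(** The kernels witnessing conditional independence may be versions other than
    [k]; for fixed [B] and [C] they agree with [k] up to a null set, which is
    enough under the integral. *)
Lemma cond_independent_copy_law (Y Y' : {RV P >-> R}) (k : R.-pker TX ~> R)
    (B C : set R) : cond_distribution X Y k -> cond_independent_copy X Y Y' ->
  measurable B -> measurable C ->
  P (Y @^-1` B `&` Y' @^-1` C) =
    (\int[distribution P X]_x (k x B * k x C))%E.
Proof.
move=> kY [[k1 [k1' [k1Y k1'Y' k11']]] [k2 [k2' [k2Y k2'Y' ind]]]] mB mC.
have := ind setT B C measurableT mB mC; rewrite preimage_setT setTI => ->.
have mk (k0 : R.-pker TX ~> R) D : measurable D ->
    measurable_fun setT (fun x => k0 x D) by move=> mD; exact: measurable_kernel.
apply: ae_eq_integral => //.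
- by apply: emeasurable_funM; exact: mk.
- by apply: emeasurable_funM; exact: mk.
have hB := cond_distribution_ae k2Y kY mB.
have h1 := cond_distribution_ae k2'Y' k1'Y' mC.
have h2 := cond_distribution_ae k1Y kY mC.
have hC : {ae distribution P X, forall x, k2' x C = k x C}.
  move: h1 k11' h2; apply: filterS3 => x -> k11 <-.
  by apply: esym; exact: k11.
by move: hB hC; apply: filterS2 => x -> ->.
Qed.

End conditional_law.

Theorem theorem3p2 (R : realType) (d : measure_display) (T : measurableType d)
    (P : probability T R) (p : nat)
    (X : {RV P >-> p.-tuple R}) (Y Y' : {RV P >-> R})
    (k : R.-pker (p.-tuple R) ~> R)
    (Y_nondeg : not_as_constant P Y)
    (X_nondeg : exists i : 'I_p, not_as_constant P (fun w => tnth (X w) i))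
    (k_cond : cond_distribution X Y k)
    (Y'_copy : cond_independent_copy X Y Y') :
  let M := [set z : p.-tuple R | (0 < P [set w | X w = z])%E] in
  (separation_coef X k = 1 <-> completely_separated X k) /\
  (completely_separated X k <->
    exists (a b : p.-tuple R -> R) (F : p.-tuple R -> R -> R -> R),
      [/\ admits_ordinal_sum P (fun w => distr_fun Y (Y w))
            (fun w => distr_fun Y (Y' w)) M a b F,
          forall z, M z -> (b z - a z)%:E = P [set w | X w = z] &
          forall z u v, M z -> a z < u <= b z -> a z < v <= b z ->
            F z u v = F z u (b z) * F z (b z) v]).
Proof.
move=> M.
pose rho : probability (p.-tuple R) R := distribution P X.
pose m : probability R R := distribution P Y.
pose kp := kernel_probability k.
have mk U : measurable U -> measurable_fun setT (fun x => kp x U).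
  by move=> mU; exact: (measurable_kernel k U mU).
have mset1 (z : p.-tuple R) : measurable [set z] by exact: measurable_tuple_set1.
have mE B : measurable B -> (m B = \int[rho]_x kp x B)%E.
  move=> mB; have := k_cond setT B measurableT mB.
  by rewrite preimage_setT setTI.
have jointE u v : joint_cdf P (fun w => distr_fun Y (Y w))
    (fun w => distr_fun Y (Y' w)) u v =
    (\int[rho]_x (kp x (cdf_level m u) * kp x (cdf_level m v)))%E.
  exact: (cond_independent_copy_law k_cond Y'_copy
    (measurable_cdf_level m u) (measurable_cdf_level m v)).
split.
  (* [X] is not almost surely equal to any [x], since one coordinate is not *)
  apply: (@separation_coef_eq1 _ _ _ rho kp mk measurable_tuple_diagonal) => x.
  apply/eqP => x1; have [i] := X_nondeg; apply; exists (tnth x i).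
  exists (~` (X @^-1` [set x])); split.
  - by apply: measurableC; exact: measurable_funPTI.
  - rewrite probability_setC; last exact: measurable_funPTI.
    by rewrite [X in (1 - X)%E]x1 subee.
  - by move=> w /= Xwi Xw; apply: Xwi; rewrite Xw.
split=> [sep|[a [b [F [[ord_data ordE] blockE _]]]]]; last first.
  apply: (@ordinal_sum_separates _ _ _ rho kp m mk mset1 a b F) => // u v u01 v01.
  by rewrite -jointE ordE.
exists (block_low rho kp), (block_high rho kp), (block_cdf kp m); split.
- split; first split.
  + exact: (@countable_atoms _ _ _ rho mset1).
  + move=> z Mz; split; [exact: block_low_ge0|split].
      exact: block_low_lt_high.
    exact: block_high_le1.
  + exact: (trivIset_block mk mset1 mE sep).
  + by move=> z Mz; exact: (block_cdf_supported mk mset1 mE sep Mz).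
  by move=> u v u01 v01; rewrite jointE; exact: (separated_ordinal_sum mk mset1 mE sep).
- move=> z Mz; rewrite /block_high addrAC subrr add0r.
  by rewrite EFin_fine_probability.
- move=> z u v Mz uz vz; rewrite /block_cdf.
  by rewrite (kernel_lev_high mk mset1 mE sep Mz) mulr1 mul1r.
Qed.
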